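(* There is an absolute constant $C$ such that for all sufficiently large $n$ and every $s\ge n$ there is a distribution $\mathcal{D}$ over centrally symmetric convex subsets of $\mathbb{R}^n$ with the following property: for every (possibly randomized) membership-query algorithm $A$ that makes at most $s$ queries to an oracle returning $\mathbf{1}[y\in\mathbf{f}]$ on query $y\in\mathbb{R}^n$, where $\mathbf{f}\sim\mathcal{D}$, and then outputs a hypothesis $h:\mathbb{R}^n\to\{0,1\}$, we have \[ \Pr_{\mathbf{f}\sim\mathcal{D},\,A,\,\mathbf{x}\sim N(0,I_n)}\big[h(\mathbf{x})\neq \mathbf{1}[\mathbf{x}\in\mathbf{f}]\big]\ge \frac12-\frac{C\log(s)\sqrt{\log n}}{\sqrt n}. \]
   Context: A set is centrally symmetric if $x\in K\iff -x\in K$. $N(0,I_n)$ is the standard Gaussian on $\mathbb{R}^n$. *)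

(* Defs.v *)
From HB Require Import structures.
From mathcomp Require Import all_boot all_order all_algebra.
From mathcomp Require Import all_classical all_reals all_analysis.
Set Implicit Arguments. Unset Strict Implicit. Unset Printing Implicit Defensive.
Import Order.TTheory GRing.Theory Num.Theory.
Local Open Scope classical_set_scope.
Local Open Scope ring_scope.

Definition vec (R : realType) (n : nat) := 'rV[R]_n.
HB.instance Definition _ (R : realType) n := GRing.Lmodule.on (vec R n).
HB.instance Definition _ (R : realType) n := Choice.on (vec R n).
HB.instance Definition _ (R : realType) n := isPointed.Build (vec R n) 0.

Definition vec_display : measure_display -> measure_display. Proof. exact. Qed.

(* Borel sigma-algebra on R^n = product sigma-algebra generated by coordinates *)
Section vec_measurable.
Context (R : realType) (n : nat).
Let coord : 'I_n -> vec R n -> R := fun i v => v ord0 i.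
Let vec_set0 : g_sigma_preimage coord set0.
Proof. exact: sigma_algebra0. Qed.
Let vec_setC A : g_sigma_preimage coord A -> g_sigma_preimage coord (~` A).
Proof. exact: sigma_algebraC. Qed.
Let vec_bigcup (F : _^nat) : (forall i, g_sigma_preimage coord (F i)) ->
  g_sigma_preimage coord (\bigcup_i (F i)).
Proof. exact: sigma_algebra_bigcup. Qed.
HB.instance Definition _ := @isMeasurable.Build (vec_display default_measure_display)
  (vec R n) (g_sigma_preimage coord) vec_set0 vec_setC vec_bigcup.
End vec_measurable.

Definition convex_vec (R : realType) n (K : set (vec R n)) : Prop :=
  forall x y (t : R), K x -> K y -> 0 <= t <= 1 -> K (t *: x + (1 - t) *: y).

Definition centrally_symmetric (R : realType) n (K : set (vec R n)) : Prop :=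
  forall x : vec R n, K x <-> K (- x).

(* Expectation E_{x ~ N(0, I_n)}[g x] for nonnegative g, as the iterated
   integral over the n independent standard normal coordinates. *)
Fixpoint gauss_iter (R : realType) (k : nat) : (seq R -> \bar R) -> \bar R :=
  match k with
  | 0 => fun g => g [::]
  | k'.+1 => fun g =>
      (\int[normal_prob 0 1]_t gauss_iter k' (fun l => g (t :: l)))%E
  end.

Definition gauss_expect (R : realType) n (g : vec R n -> \bar R) : \bar R :=
  gauss_iter n (fun l => g (\row_(i < n) nth 0 l i)).

(* Adaptive membership-query transcript: q maps the answers so far to the
   next query; after k queries to the oracle, the list of the k answers. *)
Fixpoint answers (V : Type) (oracle : V -> bool) (q : seq bool -> V) (k : nat)
  : seq bool :=
  match k with
  | 0 => [::]
  | k'.+1 => let a := answers oracle q k' in rcons a (oracle (q a))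
  end.

(* Error probability Pr_{f ~ D, A, x ~ N(0,I_n)}[h(x) <> 1[x in f]] where
   D is the law of K under P, the algorithm's randomness is u ~ Q,
   it asks s queries (q u) and outputs hypothesis h u (answers). *)
Definition mq_error (R : realType) n
  d (T : measurableType d) (P : probability T R) (K : T -> set (vec R n))
  d' (U : measurableType d') (Q : probability U R)
  (q : U -> seq bool -> vec R n) (h : U -> seq bool -> vec R n -> bool)
  (s : nat) : \bar R :=
  (\int[P]_w \int[Q]_u gauss_expect (fun x =>
      ((h u (answers (fun y => `[< K w y >]) (q u) s) x) != `[< K w x >])%:R%:E))%E.

(* Main.v *)
(** The hard body is an intersection of slabs [|v_i . x| <= theta], where each of
    finitely many fixed slabs is present independently with probability [c].

    Information: answering a query [y] with "no" can be charged to one present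
    slab [i] violated by [y].  Compare the run on the random subfamily with the
    run on the subfamily from which all slabs violated by the test point [x]
    have been removed; the latter is independent of whether [x] lies in the
    body.  The two transcripts differ only if one of the at most [s] charged
    slabs is violated by [x], and for a fixed slab this has probability at most
    [p], a Gaussian tail, hence polynomially small in [s] when
    [theta ~ sqrt (n log s)].

    Balance: [x] lies in the body with probability [(1 - c) ^ S x], [S x] being
    the number of slabs violated by [x].  The normals [v_i] are chosen greedily
    so that [S x] is close in mean square to its expectation for Gaussian
    normals, which depends on [|x|] only, through the tail of a normal variable
    of standard deviation [|x|].  As [|x|^2 = n (1 + O(n^(-1/2)))], that tail is
    constant up to a relative error [O(log s / sqrt n)], and [c] is tuned to make
    the probability [1/2]. *)

Require Import Defs.
From HB Require Import structures.
From mathcomp Require Import all_boot all_order all_algebra.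
From mathcomp Require Import all_classical all_reals all_analysis.
From mathcomp Require Import measurable_realfun ring lra.
Import Order.TTheory GRing.Theory Num.Theory.
Local Open Scope classical_set_scope.
Local Open Scope ring_scope.
Import numFieldNormedType.Exports.
Set Implicit Arguments. Unset Strict Implicit. Unset Printing Implicit Defensive.

(** * Integration against the normal law *)

Section density.
Local Open Scope ereal_scope.
Context {R : realType}.
Local Notation mu := lebesgue_measure.
Import HBNNSimple.

Let mpre (g : {nnsfun R >-> R}) r : measurable (g @^-1` [set r]).
Proof. by rewrite -[X in measurable X]setTI; exact: measurable_funP. Qed.

(** Monotone convergence along simple approximations reduces the change of measure to indicators,
    where it is the definition of [normal_prob]. *)
Lemma ge0_integral_normal_prob (m s : R) (f : R -> \bar R) :
  measurable_fun [set: R] f -> (forall x, 0 <= f x) ->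
  \int[normal_prob m s]_x f x = \int[mu]_x (f x * (normal_pdf m s x)%:E).
Proof.
move=> mf f0.
have mpdf : measurable_fun setT (fun x : R => (normal_pdf m s x)%:E).
  by apply/measurable_EFinP; exact: measurable_normal_pdf.
have pdf0 x : 0 <= (normal_pdf m s x)%:E by rewrite lee_fin normal_pdf_ge0.
pose f_ := nnsfun_approx measurableT mf.
have mf_ n : measurable_fun setT (fun x => (f_ n x)%:E) by exact/measurable_EFinP.
transitivity (lim (\int[normal_prob m s]_x (f_ n x)%:E @[n --> \oo])).
  rewrite -monotone_convergence//=.
  - by apply: eq_integral => ? _; apply/esym/cvg_lim => //=; exact: cvg_nnsfun_approx.
  - by move=> n ? _; rewrite lee_fin.
  - by move=> ? _ ? ? mn; rewrite lee_fin; have /lefP := nd_nnsfun_approx measurableT mf mn; exact.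
transitivity (lim (\int[mu]_x ((f_ n x)%:E * (normal_pdf m s x)%:E) @[n --> \oo])); last first.
  rewrite -monotone_convergence//=.
  - apply: eq_integral => x _; apply/cvg_lim => //=.
    by apply: cvgeZr => //; exact: cvg_nnsfun_approx.
  - by move=> n; apply: emeasurable_funM => //; exact: mf_.
  - by move=> n ? _; rewrite mule_ge0// lee_fin.
  - move=> ? _ ? ? mn; rewrite lee_wpmul2r// lee_fin.
    by have /lefP := nd_nnsfun_approx measurableT mf mn; exact.
apply: congr_lim; apply/funext => n /=.
move: (f_ n) => {f_ mf_} g.
under [LHS]eq_integral do rewrite fimfunE -fsumEFin//.
rewrite [LHS]ge0_integral_fsum//; last 2 first.
  - by move=> r; apply/measurable_EFinP; apply: measurable_funM => //; apply: measurable_indic; exact: mpre.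
  - by move=> k x _; rewrite EFinM nnfun_muleindic_ge0.
under [RHS]eq_integral.
  move=> x xD; rewrite fimfunE -fsumEFin// ge0_mule_fsuml; last first.
    by move=> r; rewrite EFinM nnfun_muleindic_ge0.
  over.
rewrite [RHS]ge0_integral_fsum//; last 2 first.
  - move=> r; apply: emeasurable_funM => //.
    by apply/measurable_EFinP; apply: measurable_funM => //; apply: measurable_indic; exact: mpre.
  - by move=> k x _; rewrite mule_ge0// EFinM nnfun_muleindic_ge0.
apply: eq_fsbigr => r _.
have mE := mpre g r.
under [RHS]eq_integral do rewrite EFinM -muleA.
(* A nonnegative simple function has empty fibre over a negative value. *)
have [r0|r0] := ltP r 0%R.
  rewrite !integral0_eq// => x _; rewrite ?EFinM preimage_nnfun0// indicE in_set0 ?mul0e ?mule0//.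
rewrite [RHS]ge0_integralZl//; last 2 first.
- by apply: emeasurable_funM => //; apply/measurable_EFinP.
- by move=> x _; rewrite mule_ge0.
under [LHS]eq_integral do rewrite EFinM.
rewrite ge0_integralZl//; last exact/measurable_EFinP.
congr (_ * _); rewrite integral_indic// setIT [LHS]integral_mkcond.
apply: eq_integral => x _; rewrite patchE indicE.
by case: ifPn => _; rewrite ?mul1e ?mul0e.
Qed.

(** The pushforward of Lebesgue measure under [x |-> a x + b], scaled by [a], gives every half-open
    interval its length, hence is Lebesgue measure by uniqueness. *)
Lemma ge0_integral_affine (a b : R) (f : R -> \bar R) : (0 < a)%R ->
  measurable_fun [set: R] f -> (forall x, 0 <= f x) ->
  \int[mu]_x f x = a%:E * \int[mu]_x f (a * x + b)%R.
Proof.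
move=> a0 mf f0.
pose g : R -> measurableTypeR R := fun x => (a * x + b)%R.
have mg : measurable_fun [set: R] g.
  by apply: measurable_funD => //; apply: measurable_funM.
have a_ge0 : (0 <= a)%R := ltW a0.
pose nu : {measure set (measurableTypeR R) -> \bar R} :=
  measure_function_pushforward__canonical__measure_function_Measure mu mg.
transitivity (\int[mscale (NngNum a_ge0) nu]_x f x).
  apply: eq_measure_integral => A mA _.
  apply: lebesgue_measure_unique => //= _ [[c d]] _ <-.
  rewrite /mscale/= /pushforward/=.
  have -> : g @^-1` `]c, d]%classic = `]((c - b) / a)%R, ((d - b) / a)%R]%classic.
    apply/seteqP; split => x /=; rewrite /g !in_itv/= ltr_pdivrMr// ler_pdivlMr//;
    by move=> /andP[? ?]; apply/andP; split; lra.
  rewrite !lebesgue_measure_itv/= !lte_fin ltr_pM2r ?invr_gt0// ltrD2r.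
  case: ifPn => _; last by rewrite mule0.
  by rewrite -!EFinB -EFinM; congr EFin; field; rewrite gt_eqF.
rewrite ge0_integral_mscale//=.
by rewrite ge0_integral_pushforward.
Qed.

Lemma ge0_integral_oppr (f : R -> \bar R) :
  measurable_fun [set: R] f -> (forall x, 0 <= f x) ->
  \int[mu]_x f x = \int[mu]_x f (- x)%R.
Proof.
move=> mf f0.
pose g : R -> measurableTypeR R := fun x => (- x)%R.
have mg : measurable_fun [set: R] g by exact: measurable_funN.
pose nu : {measure set (measurableTypeR R) -> \bar R} :=
  measure_function_pushforward__canonical__measure_function_Measure mu mg.
transitivity (\int[nu]_x f x).
  by apply: eq_measure_integral => A mA _; exact/esym/lebesgue_measureN.
by rewrite ge0_integral_pushforward.
Qed.

End density.

Lemma integral_probability_cst d (T : measurableType d) (R : realType)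
  (P : probability T R) (c : \bar R) : (\int[P]_x c = c)%E.
Proof. by rewrite integral_cst//= probability_setT mule1. Qed.

Lemma integral_normal_cst (R : realType) (c : \bar R) :
  (\int[@normal_prob R 0 1]_x c = c)%E.
Proof. exact: (integral_probability_cst (normal_prob 0 1)). Qed.

(** * Sums of independent normal variables *)

Section gaussian_convolution.
Context {R : realType}.
Implicit Types (a b s m x y : R) (f : R -> \bar R).
Local Notation mu := lebesgue_measure.

Lemma normal_pdf_gt0E m s x : 0 < s -> normal_pdf m s x =
  (s * Num.sqrt (pi *+ 2))^-1 * expR (- (x - m) ^+ 2 / (s ^+ 2 *+ 2)).
Proof.
move=> s0; rewrite normal_pdfE ?gt_eqF// /normal_peak /normal_fun.
by rewrite -mulrnAr sqrtrM ?sqr_ge0// sqrtr_sqr gtr0_norm.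
Qed.

Lemma normal_pdf_affine m s x : 0 < s ->
  s * normal_pdf m s (s * x + m) = normal_pdf 0 1 x.
Proof.
move=> s0; rewrite !normal_pdf_gt0E// addrK subr0 mul1r invfM !mulrA divff ?gt_eqF// mul1r.
congr (_ * expR _); rewrite expr1n; field.
by rewrite gt_eqF.
Qed.

Lemma ge0_integral_normal_affine m s f : 0 < s ->
  measurable_fun [set: R] f -> (forall x, 0 <= f x)%E ->
  (\int[normal_prob 0 1]_z f (s * z + m)%R = \int[mu]_y (f y * (normal_pdf m s y)%:E))%E.
Proof.
move=> s0 mf f0.
have maff : measurable_fun [set: R] (fun z => f (s * z + m)).
  apply: measurableT_comp => //; apply: measurable_funD => //.
have mpdf m' s' : measurable_fun [set: R] (fun x : R => (normal_pdf m' s' x)%:E).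
  by apply/measurable_EFinP; exact: measurable_normal_pdf.
rewrite [LHS](ge0_integral_normal_prob 0 1 maff (fun z => f0 _)).
rewrite [RHS](ge0_integral_affine m s0)//; last 2 first.
- exact: emeasurable_funM.
- by move=> x; rewrite mule_ge0// lee_fin normal_pdf_ge0.
rewrite -ge0_integralZl//; last 3 first.
- apply: emeasurable_funM => //; apply/measurable_EFinP.
  apply: measurableT_comp; first exact: measurable_normal_pdf.
  by apply: measurable_funD => //; exact: measurable_funM.
- by move=> x _; rewrite mule_ge0// lee_fin normal_pdf_ge0.
- by rewrite lee_fin ltW.
by apply: eq_integral => x _; rewrite muleCA -EFinM normal_pdf_affine.
Qed.

(* Completing the square: the joint density of (t, a t + b z) factors through
   the law of the sum and the conditional law of t. *)
Lemma normal_pdf_condition a b t y : 0 < b -> let s := Num.sqrt (a ^+ 2 + b ^+ 2) in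
  normal_pdf (a * t) b y * normal_pdf 0 1 t =
  normal_pdf 0 s y * normal_pdf (a * y / s ^+ 2) (b / s) t.
Proof.
move=> b0 s.
have ab0 : 0 < a ^+ 2 + b ^+ 2 by rewrite ltr_wpDl ?sqr_ge0// exprn_gt0.
have s0 : 0 < s by rewrite sqrtr_gt0.
have s2 : s ^+ 2 = a ^+ 2 + b ^+ 2 by rewrite sqr_sqrtr// ltW.
have bs0 : 0 < b / s by rewrite divr_gt0.
rewrite !normal_pdf_gt0E// mulrACA [RHS]mulrACA -!expRD !subr0 mul1r.
have p0 : Num.sqrt (pi *+ 2) != 0 :> R by rewrite gt_eqF// sqrtr_gt0 pmulrn_lgt0// pi_gt0.
congr (_ * expR _).
  by field; rewrite p0 !gt_eqF.
rewrite expr_div_n s2; field.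
by rewrite !gt_eqF.
Qed.

(** After Tonelli, [normal_pdf_condition] splits the joint density into the density of the sum and a
    conditional density of [t], which integrates to 1. Positivity of [b] provides the inner variable
    with a density. *)
Lemma ge0_integral_normal_convolution a b f : 0 < b ->
  measurable_fun [set: R] f -> (forall x, 0 <= f x)%E ->
  (\int[normal_prob 0 1]_t \int[normal_prob 0 1]_z f (a * t + b * z)%R =
   \int[normal_prob 0 1]_z f (Num.sqrt (a ^+ 2 + b ^+ 2) * z)%R)%E.
Proof.
move=> b0 mf f0; set s := Num.sqrt _.
have s0 : 0 < s by rewrite sqrtr_gt0 ltr_wpDl ?sqr_ge0// exprn_gt0.
have pdf0 m' s' x : (0 <= (normal_pdf m' s' x)%:E)%E by rewrite lee_fin normal_pdf_ge0.
have mpdf m' s' : measurable_fun [set: R] (fun x : R => (normal_pdf m' s' x)%:E).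
  by apply/measurable_EFinP; exact: measurable_normal_pdf.
have mjoint : measurable_fun [set: R * R]
    (fun p => f p.2 * (normal_pdf (a * p.1) b p.2)%:E)%E.
  apply: emeasurable_funM; first exact: measurableT_comp.
  apply/measurable_EFinP.
  under eq_fun do rewrite normal_pdf_gt0E//.
  apply: measurable_funM => //; apply: measurableT_comp => //.
  apply: measurable_funM => //; apply: measurableT_comp => //.
  apply: measurable_funX; apply: measurable_funB => //.
  exact: measurable_funM.
under eq_integral do under eq_integral do rewrite addrC.
under eq_integral do rewrite ge0_integral_normal_affine//.
rewrite [LHS]ge0_integral_normal_prob//; last 2 first.
- have joint0 (p : R * R) : (0 <= f p.2 * (normal_pdf (a * p.1) b p.2)%:E)%E.
    by rewrite mule_ge0.
  exact: (measurable_fun_fubini_tonelli_F (m2 := mu) _ mjoint joint0).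
- by move=> x; apply: integral_ge0 => y _; rewrite mule_ge0.
transitivity (\int[mu]_t \int[mu]_y (f y * (normal_pdf (a * t) b y)%:E *
                (normal_pdf 0 1 t)%:E))%E.
  apply: eq_integral => t _; rewrite -ge0_integralZr//.
  - exact: (emeasurable_funM mf (mpdf _ _)).
  - by move=> x _; rewrite mule_ge0.
rewrite (fubini_tonelli (m1 := mu) (m2 := mu)
   (fun p => f p.2 * (normal_pdf (a * p.1) b p.2)%:E * (normal_pdf 0 1 p.1)%:E)%E)/=; last 2 first.
- by apply: emeasurable_funM => //; exact: (measurableT_comp (mpdf 0 1) measurable_fst).
- by move=> p; rewrite !mule_ge0.
transitivity (\int[mu]_y (f y * (normal_pdf 0 s y)%:E))%E; last first.
  rewrite -ge0_integral_normal_affine//.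
  by under eq_integral do rewrite addr0.
apply: eq_integral => y _.
transitivity (\int[mu]_t ((f y * (normal_pdf 0 s y)%:E) *
   (normal_pdf (a * y / s ^+ 2) (b / s) t)%:E))%E.
  apply: eq_integral => t _.
  by rewrite -muleA -EFinM normal_pdf_condition// EFinM muleA.
rewrite ge0_integralZl//; last 2 first.
- exact: mpdf.
- by rewrite mule_ge0.
by rewrite integral_normal_pdf mule1.
Qed.

End gaussian_convolution.

(** * Gaussian tails *)

Section gaussian_tail.
Context {R : realType}.
Implicit Types (a b u t x z l : R).
Local Notation mu := lebesgue_measure.
Local Notation N01 := (@normal_prob R 0 1).
Local Notation phi := (@normal_pdf R 0 1).

Lemma measurable_absgt u : measurable [set z : R | u < `|z|].
Proof.
have -> : [set z : R | u < `|z|] = (@Num.norm R R) @^-1` `]u, +oo[%classic.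
  by apply/seteqP; split => z /=; rewrite in_itv/= andbT.
rewrite -[X in measurable X]setTI; exact: (@normr_measurable R setT).
Qed.

Definition gtail u : R := fine (N01 [set z | u < `|z|]).

Lemma gtailE u : N01 [set z | u < `|z|] = (gtail u)%:E.
Proof. by rewrite fineK// fin_num_measure//; exact: measurable_absgt. Qed.

Lemma gtail_ge0 u : 0 <= gtail u.
Proof. exact: fine_ge0. Qed.

Lemma gtail_anti a b : a <= b -> gtail b <= gtail a.
Proof.
move=> ab; rewrite -lee_fin -!gtailE le_measure// ?inE; try exact: measurable_absgt.
by move=> z /=; exact: le_lt_trans.
Qed.

Lemma gauss_pdfE x : phi x = phi 0 * expR (- (x ^+ 2 / 2)).
Proof.
rewrite !normal_pdf_gt0E// !subr0 !expr1n [in RHS]expr0n/= oppr0 mul0r expR0 mulr1.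
by rewrite mulNr.
Qed.

Lemma gauss_pdf0_gt0 : 0 < phi 0.
Proof. by rewrite normal_pdfE// mulr_gt0 ?expR_gt0// normal_peak_gt0. Qed.

Lemma gauss_pdf_gt0 x : 0 < phi x.
Proof. by rewrite gauss_pdfE mulr_gt0 ?expR_gt0// gauss_pdf0_gt0. Qed.

Lemma gauss_pdf_anti a x : 0 <= a -> a <= `|x| -> phi x <= phi a.
Proof.
move=> a0 ax; rewrite gauss_pdfE (gauss_pdfE a) ler_pM2l ?gauss_pdf0_gt0//.
rewrite ler_expR lerN2 ler_pM2r// -(real_normK (num_real x)).
by rewrite lerXn2r// nnegrE.
Qed.

Lemma gauss_itv_le a b c : a <= b -> (forall x, x \in `]a, b] -> phi x <= c) ->
  (N01 `]a, b]%classic <= ((b - a) * c)%:E)%E.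
Proof.
move=> ab h.
have c0 : 0 <= phi b by rewrite normal_pdf_ge0.
apply: (@le_trans _ _ (\int[mu]_(x in `]a, b]) (cst c%:E x))%E).
  apply: ge0_le_integral => //.
  - by move=> x _; rewrite lee_fin normal_pdf_ge0.
  - by apply/measurable_EFinP/measurable_funTS; exact: measurable_normal_pdf.
rewrite integral_cst//= lebesgue_measure_itv/= lte_fin.
case: ltP => [ab'|ba]; first by rewrite -EFinB -EFinM mulrC.
have -> : b = a by apply/eqP; rewrite eq_le ab andbT.
by rewrite subrr mul0r mule0.
Qed.

Lemma gauss_itv_ge a b c : a <= b -> 0 <= c -> (forall x, x \in `]a, b] -> c <= phi x) ->
  (((b - a) * c)%:E <= N01 `]a, b]%classic)%E.
Proof.
move=> ab c0 h.
apply: (@le_trans _ _ (\int[mu]_(x in `]a, b]) (cst c%:E x))%E); last first.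
  apply: ge0_le_integral => //.
  - by apply/measurable_EFinP/measurable_funTS; exact: measurable_normal_pdf.
rewrite integral_cst//= lebesgue_measure_itv/= lte_fin.
case: ltP => [ab'|ba]; first by rewrite -EFinB -EFinM mulrC.
have -> : b = a by apply/eqP; rewrite eq_le ab andbT.
by rewrite subrr mul0r mule0.
Qed.

(** The shell [a < |z| <= b] consists of two intervals of length [b - a], on which the density is at
    most [phi a]. *)
Lemma gtail_sub_le a b : 0 <= a -> a <= b -> gtail a - gtail b <= 2 * (b - a) * phi a.
Proof.
move=> a0 ab; rewrite lerBlDr -lee_fin EFinD -!gtailE.
have bound c : (forall x, x \in `]c, c + (b - a)] -> a <= `|x|) ->
    (N01 `]c, (c + (b - a))%R]%classic <= ((b - a) * phi a)%:E)%E.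
  move=> h; apply: (le_trans (gauss_itv_le _ (fun x xI => gauss_pdf_anti a0 (h x xI)))).
    by rewrite lerDl subr_ge0.
  by rewrite addrAC subrr add0r.
(* The negative half of the shell contains its left end [- b], so this null point is split off to
   leave a half-open interval. *)
have sub : [set z : R | a < `|z|] `<=` `]a, (a + (b - a))%R] `|`
   ([set - b] `|` `](- b), (- b + (b - a))%R]) `|` [set z | b < `|z|].
  move=> z /= az; have [bz|zb] := ltP b `|z|; [by right|left].
  rewrite !in_itv/=; move: az zb; have [z0|z0] := leP 0 z; rewrite ?(ger0_norm z0) ?(ltr0_norm z0) => az zb.
    by left; apply/andP; split; lra.
  right; have [->|zb'] := eqVneq z (- b); [by left|right].
  by rewrite lt_neqAle eq_sym zb'/=; apply/andP; split; lra.
have mU2 (A B : set R) : measurable A -> measurable B ->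
  (N01 (A `|` B) <= N01 A + N01 B)%E by move=> mA mB; exact: (@measureU2 _ _ _ (normal_prob 0 1) A B mA mB).
have mI (c d : R) : measurable (`]c, d]%classic : set R) by [].
apply: (le_trans (le_measure N01 _ _ sub)); rewrite ?inE; first exact: measurable_absgt.
  by apply: measurableU; [do 2 apply: measurableU => // | exact: measurable_absgt].
apply: (le_trans (mU2 _ _ _ _)); [by do 2 apply: measurableU => // | exact: measurable_absgt |].
apply: leeD => //; apply: (le_trans (mU2 _ _ _ _)) => //; first exact: measurableU.
have -> : 2 * (b - a) * phi a = (b - a) * phi a + (b - a) * phi a by ring.
rewrite EFinD; apply: leeD.
  by apply: bound => x; rewrite in_itv/= => /andP[/ltW ax _]; rewrite ger0_norm//; lra.
apply: (le_trans (mU2 _ _ _ _)) => //.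
rewrite (_ : N01 [set (- b)%R] = 0%E); last exact: integral_set1.
rewrite add0e; apply: bound => x; rewrite in_itv/= => /andP[_ xa].
by rewrite ler0_norm; lra.
Qed.

Lemma gtail_ge a b : 0 <= a -> a <= b -> (b - a) * phi b <= gtail a.
Proof.
move=> a0 ab; rewrite -lee_fin -gtailE.
apply: (le_trans (gauss_itv_ge ab _ _)).
- exact: normal_pdf_ge0.
- move=> x; rewrite in_itv/= => /andP[ax xb].
  have x0 : 0 <= x by lra.
  by apply: gauss_pdf_anti => //; rewrite ger0_norm//; lra.
apply: le_measure; rewrite ?inE//; first exact: measurable_absgt.
move=> x /=; rewrite in_itv/= => /andP[ax _].
by rewrite ger0_norm//; lra.
Qed.

(** Tilting by [expR (z ^+ 2 / 4)] turns the density of variance 1 into that of variance 2, up to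
    the ratio [sqrt 2] of the normalizations. *)
Lemma gauss_mgf : (\int[N01]_z (expR (z ^+ 2 / 4))%:E = (Num.sqrt 2)%:E)%E.
Proof.
have s0 : 0 < Num.sqrt 2 :> R by rewrite sqrtr_gt0.
have mexp : measurable_fun [set: R] (fun z => (expR (z ^+ 2 / 4))%:E).
  apply/measurable_EFinP; apply: measurableT_comp => //.
  by apply: measurable_funM => //; exact: measurable_funX.
rewrite ge0_integral_normal_prob//.
transitivity (\int[mu]_z ((Num.sqrt 2)%:E * (normal_pdf 0 (Num.sqrt 2) z)%:E) : \bar R)%E.
  apply: eq_integral => z _; rewrite -!EFinM; congr EFin.
  rewrite !normal_pdf_gt0E// !subr0 mul1r invfM !mulrA divff ?gt_eqF// mul1r.
  rewrite mulrAC -expRD mulrC; congr (_ * expR _).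
  by rewrite sqr_sqrtr//; field.
rewrite ge0_integralZl//.
- by rewrite integral_normal_pdf mule1.
- by apply/measurable_EFinP; exact: measurable_normal_pdf.
- by move=> x _; rewrite lee_fin normal_pdf_ge0.
Qed.

End gaussian_tail.

(** * Tail estimates, moments, and stability of the tail under rescaling *)

Section gaussian_tail_ratio.
Context {R : realType}.
Implicit Types (a b u t x z l : R).
Local Notation mu := lebesgue_measure.
Local Notation N01 := (@normal_prob R 0 1).
Local Notation phi := (@normal_pdf R 0 1).

Let mexp : measurable_fun [set: R] (fun z => (expR (z ^+ 2 / 4))%:E).
Proof.
apply/measurable_EFinP; apply: measurableT_comp => //.
by apply: measurable_funM => //; exact: measurable_funX.
Qed.

(** Markov's inequality for [expR (z ^+ 2 / 4)]. *)
Lemma gtail_le_exp u : 0 <= u -> gtail u <= Num.sqrt 2 * expR (- (u ^+ 2 / 4)).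
Proof.
move=> u0; rewrite expRN -ler_pdivrMr ?invr_gt0 ?expR_gt0// invrK.
rewrite -lee_fin -gauss_mgf mulrC EFinM -gtailE.
rewrite -[X in N01 X]setIT -integral_indic//; last exact: measurable_absgt.
rewrite -ge0_integralZl//; last first.
  by apply/measurable_EFinP; apply: measurable_indic; exact: measurable_absgt.
apply: ge0_le_integral => //.
- apply: measurable_funeM; apply/measurable_EFinP; apply: measurable_indic.
  exact: measurable_absgt.
move=> x _; rewrite indicE; case: (boolP (x \in _)); last by rewrite mule0 lee_fin expR_ge0.
rewrite inE/= => ux; rewrite mule1 lee_fin ler_expR ler_pM2r// -(real_normK (num_real x)).
by rewrite lerXn2r// ?nnegrE// ltW.
Qed.

Lemma le_expR_half_sqr x : 0 <= x -> x ^+ 2 <= 4 * expR x.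
Proof.
move=> x0; have := expR_ge1Dx (x / 2) => h.
have -> : expR x = expR (x / 2) ^+ 2 by rewrite -expRM_natl; congr expR; field.
have : (x / 2) ^+ 2 <= expR (x / 2) ^+ 2.
  by apply: lerXn2r; rewrite ?nnegrE ?expR_ge0//; lra.
by rewrite expr_div_n; lra.
Qed.

Definition gmoment k : R := fine (\int[N01]_z (z ^+ k)%:E).

(** Finiteness by domination with the integrand of [gauss_mgf]. The constant 64 is the one that
    [le_expR_half_sqr] at [z ^+ 2 / 4] gives for the fourth power. *)
Let mom_le k : ~~ odd k -> (forall z, z ^+ k <= 64 * expR (z ^+ 2 / 4)) ->
  (\int[N01]_z (z ^+ k)%:E = (gmoment k)%:E)%E.
Proof.
move=> ok h.
have z0 z : 0 <= z ^+ k by rewrite exprn_even_ge0.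
rewrite fineK// ge0_fin_numE; last by apply: integral_ge0 => z _; rewrite lee_fin.
apply: (@le_lt_trans _ _ (\int[N01]_z (64%:E * (expR (z ^+ 2 / 4))%:E)))%E; last first.
  by rewrite ge0_integralZl// ?gauss_mgf -?EFinM ?ltry// => x _; rewrite lee_fin expR_ge0.
apply: ge0_le_integral => //.
- by move=> x _; rewrite lee_fin.
- by apply/measurable_EFinP; exact: measurable_funX.
- exact: measurable_funeM.
- by move=> x _; rewrite -EFinM lee_fin.
Qed.

Lemma gmoment2E : (\int[N01]_z (z ^+ 2)%:E = (gmoment 2)%:E)%E.
Proof.
apply: mom_le => // z; have := expR_ge1Dx (z ^+ 2 / 4).
have := expR_ge0 (z ^+ 2 / 4); lra.
Qed.

Lemma gmoment4E : (\int[N01]_z (z ^+ 4)%:E = (gmoment 4)%:E)%E.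
Proof.
apply: mom_le => // z.
have := @le_expR_half_sqr (z ^+ 2 / 4); rewrite mulr_ge0 ?sqr_ge0// => /(_ isT).
by rewrite expr_div_n -exprM; lra.
Qed.

(** A Mills ratio bound: on the interval of length [1 / t] to the right of [t] the density drops by
    a factor of at most [expR (3 / 2)], because the squared endpoints differ by at most 3. *)
Lemma gauss_pdf_le_gtail t : 1 <= t -> phi t <= expR 2 * t * gtail t.
Proof.
move=> t1; have t0 : 0 < t by lra.
have := @gtail_ge R t (t + t^-1) (ltW t0); rewrite lerDl invr_ge0 (ltW t0) => /(_ isT).
rewrite addrAC subrr add0r => h.
have tV1 : t^-1 <= 1 by rewrite invf_le1.
have tV0 : 0 < t^-1 by rewrite invr_gt0.
have : phi t <= expR 2 * phi (t + t^-1).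
  rewrite gauss_pdfE (gauss_pdfE (t + _)) mulrCA ler_pM2l ?gauss_pdf0_gt0// -expRD ler_expR.
  have : (t + t^-1) ^+ 2 = t ^+ 2 + 2 + t^-1 ^+ 2 by field; lra.
  have : t^-1 ^+ 2 <= 1 by rewrite exprn_ile1// ltW.
  lra.
move=> /le_trans; apply; rewrite -mulrA ler_pM2l ?expR_gt0//.
by rewrite -(ler_pM2l tV0) mulrA mulVf ?mul1r// gt_eqF.
Qed.

Lemma gtail_gt0 t : 1 <= t -> 0 < gtail t.
Proof.
move=> t1; have := lt_le_trans (gauss_pdf_gt0 t) (gauss_pdf_le_gtail t1).
by rewrite pmulr_rgt0// mulr_gt0 ?expR_gt0//; lra.
Qed.

(** The thresholds [t] and [t / sqrt l] are [O(t |l - 1|)] apart, and the density at the smaller one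
    is [O(t * gtail t)] by the Mills bound. *)
Lemma gtail_ratio t l : 1 <= t -> 0 < l -> t ^+ 2 * `|l - 1| <= 1 / 2 ->
  `|gtail (t / Num.sqrt l) - gtail t| <= 4 * expR 3 * (t ^+ 2 * `|l - 1|) * gtail t.
Proof.
move=> t1 l0 tl.
have t0 : 0 < t by lra.
have s0 : 0 < Num.sqrt l by rewrite sqrtr_gt0.
set b := t / _; have b0 : 0 < b by rewrite divr_gt0.
have b2l : b ^+ 2 * l = t ^+ 2.
  by rewrite expr_div_n sqr_sqrtr ?ltW// divfK// gt_eqF.
have T0 := gtail_ge0 t; have P0 := gauss_pdf_gt0 t.
have e2 : 0 < expR 2 :> R by rewrite expR_gt0.
have e23 : expR 2 <= expR 3 :> R by rewrite ler_expR; lra.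
have t2 : 1 <= t ^+ 2 by rewrite exprn_ege1.
have pT := gauss_pdf_le_gtail t1.
have [l1|l1] := leP 1 l.
- have lb : b <= t.
    by rewrite ler_pdivrMr// ler_peMr ?(ltW t0)// -[leLHS]sqrtr1 ler_wsqrtr.
  have := gtail_anti lb => ba.
  rewrite !ger0_norm ?subr_ge0// in tl *.
  (* The left-hand side equals [b ^+ 2 * (l - 1)], and [b <= t]. *)
  have tb2 : t ^+ 2 - b ^+ 2 <= t ^+ 2 * (l - 1).
    have : 0 <= (t ^+ 2 - b ^+ 2) * (l - 1).
      by rewrite mulr_ge0 ?subr_ge0//; apply: lerXn2r => //; rewrite nnegrE ltW.
    nra.
  have tb : t - b <= t * (l - 1).
    rewrite -(ler_pM2l t0); apply: le_trans (_ : t ^+ 2 - b ^+ 2 <= _); nra.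
  apply: (le_trans (gtail_sub_le (ltW b0) lb)).
  (* The smaller threshold is now [b]; by smallness of [t ^+ 2 * (l - 1)], moving the density from
     [b] to [t] costs a bounded factor. *)
  have pb : phi b <= expR 1 * phi t.
    rewrite gauss_pdfE (gauss_pdfE t) mulrCA ler_pM2l ?gauss_pdf0_gt0// -expRD ler_expR.
    lra.
  have e3 : expR 3 = expR 1 * expR 2 :> R by rewrite -expRD; congr expR; ring.
  have e1 : 0 < expR 1 :> R by rewrite expR_gt0.
  have pb' : phi b <= expR 3 * t * gtail t.
    by rewrite e3 -!mulrA; apply: (le_trans pb); rewrite ler_pM2l// mulrA.
  have : (t - b) * phi b <= (t * (l - 1)) * (expR 3 * t * gtail t).
    apply: ler_pM => //; first by rewrite subr_ge0.
    exact: normal_pdf_ge0.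
  have : 0 <= t * (l - 1) * (expR 3 * t * gtail t).
    by rewrite !mulr_ge0 ?expR_ge0 ?subr_ge0// ltW.
  by rewrite expr2; lra.
- have lb : t <= b.
    by rewrite ler_pdivlMr// ler_piMr ?(ltW t0)// -[leRHS]sqrtr1 ler_wsqrtr// ltW.
  have := gtail_anti lb => ba.
  rewrite (ltr0_norm (_ : l - 1 < 0)) ?subr_lt0// in tl *.
  rewrite distrC ger0_norm ?subr_ge0//.
  (* Since [1 <= t ^+ 2], the smallness hypothesis bounds [1 - l] itself by [1 / 2]. *)
  have lhalf : 1 / 2 <= l by nra.
  have tb2 : b ^+ 2 - t ^+ 2 <= 2 * (t ^+ 2 * (1 - l)).
    have bt2 : t ^+ 2 <= b ^+ 2 by apply: lerXn2r => //; rewrite nnegrE ltW.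
    have : 0 <= (b ^+ 2 - t ^+ 2) * (2 * l - 1) by rewrite mulr_ge0 ?subr_ge0//; lra.
    nra.
  have tb : b - t <= 2 * (t * (1 - l)).
    rewrite -(ler_pM2l t0); apply: le_trans (_ : b ^+ 2 - t ^+ 2 <= _); nra.
  apply: (le_trans (gtail_sub_le (ltW t0) lb)).
  have pT3 : phi t <= expR 3 * t * gtail t.
    by apply: (le_trans pT); rewrite -!mulrA ler_wpM2r// mulr_ge0// ltW.
  have : (b - t) * phi t <= (2 * (t * (1 - l))) * (expR 3 * t * gtail t).
    by apply: ler_pM => //; rewrite ?subr_ge0// ltW.
  by rewrite expr2; lra.
Qed.

(** For [a <= b], factor out [expR (- a) <= 1] and use [1 + x <= expR x] at [x = a - b]. *)
Lemma expRN_lipschitz a b : 0 <= a -> 0 <= b -> `|expR (- a) - expR (- b)| <= `|a - b|.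
Proof.
wlog ab : a b / a <= b => [hw a0 b0|a0 b0].
  by have [/hw|/ltW/hw] := leP a b; [exact | rewrite distrC (distrC a); exact].
have h : expR (- b) <= expR (- a) by rewrite ler_expR lerN2.
rewrite ger0_norm ?subr_ge0// distrC ger0_norm ?subr_ge0//.
have -> : expR (- b) = expR (- a) * expR (a - b) by rewrite -expRD; congr expR; ring.
have := expR_ge1Dx (a - b); have : expR (- a) <= 1 by rewrite -expR0 ler_expR oppr_le0.
have := expR_ge0 (- a); nra.
Qed.

Lemma ln2_le1 : ln 2 <= 1 :> R.
Proof.
rewrite -[leRHS]expRK ler_ln ?posrE ?expR_gt0//.
by have := @expR_ge1Dx R 1; lra.
Qed.

Lemma exp_ln2_lipschitz a b : 0 <= a -> 0 <= b ->
  `|expR (- (ln 2 * a)) - expR (- (ln 2 * b))| <= `|a - b|.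
Proof.
move=> a0 b0; have l0 : 0 <= ln 2 :> R by rewrite ln_ge0//; lra.
apply: le_trans (expRN_lipschitz _ _) _; rewrite ?mulr_ge0//.
by rewrite -mulrBr normrM ger0_norm// ler_piMl// ln2_le1.
Qed.

(* The constant is not optimized; for [l] far from 1 the left-hand side is at
   most [1/2] and the bound is trivial. *)
Lemma exp_gtail_ratio t l : 1 <= t -> 0 <= l ->
  `|expR (- (ln 2 * (fine (N01 [set z | t < Num.sqrt l * `|z|]) / gtail t))) - 1 / 2|
  <= 4 * expR 3 * (t ^+ 2 * `|l - 1|).
Proof.
move=> t1 l0; set r := fine _.
have t0 : 0 < t by lra.
have r0 : 0 <= r by rewrite fine_ge0.
have T0 := gtail_gt0 t1.
have l2 : 0 <= ln 2 :> R by rewrite ln_ge0//; lra.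
have e3 : 1 <= expR 3 :> R by have := @expR_ge1Dx R 3; lra.
(* With [1 / 2] in this form, the Lipschitz bound leaves only the distance of the tail ratio from
   1. *)
have half : 1 / 2 = expR (- (ln 2 * 1)) :> R by rewrite mulr1 expRN lnK ?posrE//; lra.
have [tl|tl] := leP (t ^+ 2 * `|l - 1|) (1 / 2); last first.
  apply: (@le_trans _ _ (1 / 2)); last by nra.
  have := expR_ge0 (- (ln 2 * (r / gtail t))).
  have : expR (- (ln 2 * (r / gtail t))) <= 1.
    by rewrite -[leRHS]expR0 ler_expR oppr_le0; apply: mulr_ge0 => //; apply: divr_ge0 => //; exact: ltW.
  by move=> *; rewrite ler_norml; apply/andP; split; lra.
have lgt0 : 0 < l.
  rewrite lt_neqAle l0 andbT; apply/eqP => l00; move: tl.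
  rewrite -l00 sub0r normrN1 mulr1; have : 1 <= t ^+ 2 by rewrite exprn_ege1.
  lra.
have s0 : 0 < Num.sqrt l by rewrite sqrtr_gt0.
have rE : r = gtail (t / Num.sqrt l).
  rewrite /r /gtail; congr (fine (N01 _)); apply/seteqP; split => z /=.
    by rewrite ltr_pdivrMr// mulrC.
  by rewrite ltr_pdivrMr// mulrC.
rewrite half; apply: (le_trans (exp_ln2_lipschitz (divr_ge0 r0 (ltW T0)) ler01)).
have -> : r / gtail t - 1 = (r - gtail t) / gtail t by field; rewrite gt_eqF.
rewrite normrM normfV (gtr0_norm T0) ler_pdivrMr// rE.
exact: gtail_ratio.
Qed.

End gaussian_tail_ratio.

(** * The standard Gaussian measure on vectors *)

Section vec_measurability.
Context {R : realType}.

Lemma measurable_vec_coord n (i : 'I_n) :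
  measurable_fun [set: vec R n] (fun v : vec R n => v ord0 i).
Proof.
move=> _ Y mY; rewrite setTI; apply: sub_sigma_algebra => /=.
rewrite -bigcup_seq/=; exists i => /=; first by rewrite mem_index_enum.
by exists Y => //; rewrite setTI.
Qed.

Lemma measurable_vec d (T : measurableType d) n (f : T -> vec R n) :
  (forall i, measurable_fun [set: T] (fun x => f x ord0 i)) ->
  measurable_fun [set: T] f.
Proof.
move=> mf.
suff : g_sigma_preimage (fun i => (fun v : vec R n => v ord0 i) \o f) `<=` measurable.
  by rewrite g_sigma_preimage_comp => prefS _ A mA; apply: prefS; exists A.
apply: smallest_sub; first exact: sigma_algebra_measurable.
(* In dimension 0 the generating family is empty. *)
case: n => [|n] in f mf *; first by rewrite big_ord0.
rewrite -bigcup_mkord_ord; apply: bigcup_sub => i Ii.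
by move=> A [B mB <-]; exact: mf.
Qed.

Definition vcons n (t : R) (v : vec R n) : vec R n.+1 :=
  \row_i oapp (v ord0) t (unlift ord0 i).

Definition vtail n (v : vec R n.+1) : vec R n := \row_i v ord0 (lift ord0 i).

Lemma vcons0 n t (v : vec R n) : vcons t v ord0 ord0 = t.
Proof. by rewrite mxE unlift_none. Qed.

Lemma vconsS n t (v : vec R n) i : vcons t v ord0 (lift ord0 i) = v ord0 i.
Proof. by rewrite mxE liftK. Qed.

Lemma vtail_vcons n t (v : vec R n) : vtail (vcons t v) = v.
Proof. by apply/rowP => i; rewrite mxE vconsS. Qed.

Definition vcons_pair n (p : measurableTypeR R * vec R n) : vec R n.+1 := vcons p.1 p.2.

Lemma measurable_vcons n : measurable_fun [set: measurableTypeR R * vec R n] (@vcons_pair n).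
Proof.
rewrite /vcons_pair.
apply: measurable_vec => i; case: (unliftP ord0 i) => [j ->|->].
  under eq_fun do rewrite vconsS.
  exact: (measurableT_comp (measurable_vec_coord j) measurable_snd).
by under eq_fun do rewrite vcons0; exact: measurable_fst.
Qed.

HB.instance Definition _ n :=
  isMeasurableFun.Build _ _ _ _ (@vcons_pair n) (@measurable_vcons n).

Definition dotv n (v x : vec R n) : R := \sum_i v ord0 i * x ord0 i.

Lemma dotv_vcons n t (v : vec R n) x :
  dotv (vcons t v) x = x ord0 ord0 * t + dotv v (vtail x).
Proof.
rewrite /dotv big_ord_recl vcons0 mulrC; congr (_ + _).
by apply: eq_bigr => i _; rewrite vconsS mxE.
Qed.

Lemma dotv_ge0 n (x : vec R n) : 0 <= dotv x x.
Proof. by rewrite sumr_ge0// => i _; rewrite -expr2 sqr_ge0. Qed.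

Lemma dotvv_vcons n t (v : vec R n) : dotv (vcons t v) (vcons t v) = t ^+ 2 + dotv v v.
Proof. by rewrite dotv_vcons vcons0 vtail_vcons. Qed.

Lemma dotvvE n (x : vec R n.+1) : dotv x x = x ord0 ord0 ^+ 2 + dotv (vtail x) (vtail x).
Proof.
by rewrite /dotv big_ord_recl; congr (_ + _); apply: eq_bigr => i _; rewrite !mxE.
Qed.

Lemma dotvC n (v x : vec R n) : dotv v x = dotv x v.
Proof. by apply: eq_bigr => i _; rewrite mulrC. Qed.

Lemma measurable_dotv n :
  measurable_fun [set: vec R n * vec R n] (fun p => dotv p.1 p.2).
Proof.
apply: measurable_sum => i; apply: measurable_funM.
  exact: (measurableT_comp (measurable_vec_coord i) measurable_fst).
exact: (measurableT_comp (measurable_vec_coord i) measurable_snd).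
Qed.

Lemma measurable_dotvl n (x : vec R n) : measurable_fun [set: vec R n] (dotv x).
Proof. by apply: measurable_sum => i; apply: measurable_funM => //; exact: measurable_vec_coord. Qed.

Lemma measurable_dotvv n : measurable_fun [set: vec R n] (fun x => dotv x x).
Proof. by apply: measurable_sum => i; apply: measurable_funM; exact: measurable_vec_coord. Qed.

End vec_measurability.

Section gaussian_measure.
Context {R : realType}.
Local Notation N01 := (@normal_prob R 0 1).
Implicit Types (t y z : R).

(** The recursion mirrors [gauss_iter], so that Tonelli peels off one coordinate at a time. *)
Fixpoint gauss n : probability (vec R n) R :=
  match n with
  | 0 => dirac (0 : vec R 0)
  | n'.+1 => distribution (N01 \x gauss n')%E (@vcons_pair R n')
  end.

Lemma integral_gauss0 (f : vec R 0 -> \bar R) : measurable_fun [set: vec R 0] f ->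
  (\int[gauss 0]_x f x = f 0%R)%E.
Proof. by move=> mf; rewrite integral_dirac// diracT mul1e. Qed.

Lemma integral_gaussS n (f : vec R n.+1 -> \bar R) :
  measurable_fun [set: vec R n.+1] f -> (forall x, 0 <= f x)%E ->
  (\int[gauss n.+1]_x f x = \int[N01]_t \int[gauss n]_v f (vcons t v))%E.
Proof.
move=> mf f0; rewrite ge0_integral_distribution//.
rewrite fubini_tonelli1//; last by move=> p; exact: f0.
exact: (measurableT_comp mf (@measurable_vcons R n)).
Qed.

(** This bridge turns the iterated integral of the statement into an integral against a probability
    measure on vectors, to which linearity and Tonelli apply. *)
Lemma gauss_expectE n (f : vec R n -> \bar R) :
  measurable_fun [set: vec R n] f -> (forall x, 0 <= f x)%E ->
  (gauss_expect f = \int[gauss n]_x f x)%E.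
Proof.
elim: n f => [|n IH] f mf f0.
  rewrite integral_gauss0// /gauss_expect/=; congr f.
  by apply/rowP => -[].
rewrite integral_gaussS// /gauss_expect/=; apply: eq_integral => t _.
rewrite -IH//; last first.
  have := measurableT_comp (measurableT_comp mf (@measurable_vcons R n)) (measurable_pair1 t).
  exact.
rewrite /gauss_expect; congr (gauss_iter _); apply/funext => l; congr f.
apply/rowP => i; rewrite mxE; case: (unliftP ord0 i) => [j ->|->].
  by rewrite vconsS mxE.
by rewrite vcons0.
Qed.

Lemma ge0_integral_normalN (f : R -> \bar R) :
  measurable_fun [set: R] f -> (forall x, 0 <= f x)%E ->
  (\int[N01]_z f (- z)%R = \int[N01]_z f z)%E.
Proof.
move=> mf f0.
have mN : measurable_fun [set: R] (fun z : R => - z) by exact: measurable_funN.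
have mpdf : measurable_fun [set: R] (fun x : R => (normal_pdf 0 1 x)%:E).
  by apply/measurable_EFinP; exact: measurable_normal_pdf.
rewrite [RHS]ge0_integral_normal_prob// ge0_integral_normal_prob//; last first.
  exact: (measurableT_comp mf mN).
have fpdf0 y : (0 <= f y * (normal_pdf 0 1 y)%:E)%E.
  by rewrite mule_ge0// lee_fin normal_pdf_ge0.
apply/esym; apply: etrans (ge0_integral_oppr (emeasurable_funM mf mpdf) fpdf0) _.
apply: eq_integral => z _; congr (_ * _%:E)%E.
by rewrite (gauss_pdfE z) (gauss_pdfE (- z)) sqrrN.
Qed.

(** By induction on the dimension: the first coordinate contributes an independent normal term,
    merged with the rest by the convolution lemma. *)
Lemma integral_gauss_dotv n (x : vec R n) (f : R -> \bar R) :
  measurable_fun [set: R] f -> (forall y, 0 <= f y)%E ->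
  (\int[gauss n]_v f (dotv v x) = \int[N01]_z f (Num.sqrt (dotv x x) * z)%R)%E.
Proof.
elim: n x f => [|n IH] x f mf f0.
  rewrite integral_gauss0//; last first.
    by under eq_fun do rewrite dotvC; exact: measurableT_comp (measurable_dotvl x).
  rewrite /dotv !big_ord0 sqrtr0; under eq_integral do rewrite mul0r.
  by rewrite integral_normal_cst.
rewrite integral_gaussS//; last first.
  by under eq_fun do rewrite dotvC; exact: measurableT_comp (measurable_dotvl x).
under eq_integral do under eq_integral do rewrite dotv_vcons.
have mfD (a : R) : measurable_fun [set: R] (fun y => f (a + y)).
  by apply: measurableT_comp => //; exact: measurable_funD.
under eq_integral => t _ do rewrite (IH (vtail x) (fun y => f (x ord0 ord0 * t + y)%R))//.
have := dotv_ge0 (vtail x); rewrite le_eqVlt => /predU1P[q0|q0]; last first.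
  rewrite ge0_integral_normal_convolution ?sqrtr_gt0// sqr_sqrtr ?ltW//.
  by rewrite -dotvvE.
(* A vanishing tail of [x] makes the inner normal degenerate, which the convolution lemma excludes.
   One coordinate remains, and evenness of the normal law absorbs its sign. *)
rewrite dotvvE -q0 addr0 sqrtr_sqr sqrtr0.
have mfM (a : R) : measurable_fun [set: R] (fun y => f (a * y)).
  by apply: measurableT_comp => //; exact: measurable_funM.
transitivity (\int[N01]_t f (x ord0 ord0 * t)%R)%E.
  apply: eq_integral => t _; under eq_integral do rewrite mul0r addr0.
  by rewrite integral_normal_cst.
have [x0|x0] := leP 0 (x ord0 ord0); first by rewrite (ger0_norm x0).
rewrite (ltr0_norm x0) -[LHS]ge0_integral_normalN//.
by apply: eq_integral => z _; rewrite mulrN mulNr.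
Qed.

End gaussian_measure.

Ltac nonneg := solve [intros; rewrite -?EFinM -?EFinD ?lee_fin;
  repeat first [done | exact: expR_ge0 | exact: sqr_ge0 | exact: dotv_ge0
    | exact: ltW | apply: addr_ge0 | by apply: exprn_even_ge0 | apply: mulr_ge0 | apply: exprn_ge0]].

(** * Moments and concentration of the squared norm *)

Section gaussian_norm.
Context {R : realType}.
Local Notation N01 := (@normal_prob R 0 1).
Local Notation m2 := (@gmoment R 2).
Local Notation m4 := (@gmoment R 4).

Let mX k : measurable_fun [set: R] (fun z : R => (z ^+ k)%:E).
Proof. by apply/measurable_EFinP; exact: measurable_funX. Qed.

Let mqX n k : measurable_fun [set: vec R n] (fun x => (dotv x x ^+ k)%:E).
Proof. by apply/measurable_EFinP; apply: measurable_funX; exact: measurable_dotvv. Qed.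

Let mq n : measurable_fun [set: vec R n] (fun x => (dotv x x)%:E).
Proof. by apply/measurable_EFinP; exact: measurable_dotvv. Qed.

Let mexpq n : measurable_fun [set: vec R n] (fun x => (expR (dotv x x / 4))%:E).
Proof.
apply/measurable_EFinP; apply: measurableT_comp => //.
by apply: measurable_funM => //; exact: measurable_dotvv.
Qed.

Let mexp : measurable_fun [set: R] (fun z => (expR (z ^+ 2 / 4))%:E).
Proof.
apply/measurable_EFinP; apply: measurableT_comp => //.
by apply: measurable_funM => //; exact: measurable_funX.
Qed.

Local Ltac side := try nonneg; try solve [exact: mX | exact: mq | exact: mqX
  | exact: mexp | exact: mexpq | apply: measurable_funeM; first [exact: mX | exact: mq | exact: mexpq]].

(** The square dominates the indicator of [1 < |z|], an event of positive probability. *)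
Lemma gmoment2_gt0 : 0 < m2.
Proof.
have h := gtail_gt0 (lexx (1 : R)); apply: (lt_le_trans h).
rewrite -lee_fin -gmoment2E -gtailE -[X in N01 X]setIT -integral_indic//; last first.
  exact: measurable_absgt.
apply: ge0_le_integral => //; side.
  by apply/measurable_EFinP; apply: measurable_indic; exact: measurable_absgt.
move=> x _; rewrite indicE; case: (boolP (x \in _)); last by rewrite lee_fin sqr_ge0.
rewrite inE/= => x1; rewrite lee_fin -(real_normK (num_real x)).
by rewrite -(expr1n _ 2); apply: lerXn2r; rewrite ?nnegrE//= ltW.
Qed.

Let m2_ge0 : 0 <= m2.
Proof. exact/ltW/gmoment2_gt0. Qed.

Lemma integral_gauss_sqnorm n :
  (\int[gauss n]_x (dotv x x)%:E = (m2 * n%:R)%:E)%E.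
Proof.
elim: n => [|n IH]; first by rewrite integral_gauss0// /dotv big_ord0 mulr0.
rewrite integral_gaussS//; side.
transitivity (\int[N01]_t ((t ^+ 2)%:E + (m2 * n%:R)%:E))%E.
  apply: eq_integral => t _.
  under eq_integral do rewrite dotvv_vcons EFinD.
  rewrite ge0_integralD//; side.
  by rewrite IH integral_probability_cst.
rewrite ge0_integralD//; side.
rewrite gmoment2E integral_normal_cst -EFinD; congr EFin.
by rewrite -natr1; ring.
Qed.

Lemma integral_gauss_sqnorm2 n :
  (\int[gauss n]_x (dotv x x ^+ 2)%:E = (m4 * n%:R + m2 ^+ 2 * (n%:R * (n%:R - 1)))%:E)%E.
Proof.
elim: n => [|n IH].
  by rewrite integral_gauss0// /dotv big_ord0; congr EFin; rewrite expr0n/=; ring.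
rewrite integral_gaussS//; side.
set M := _ + _ in IH *.
have M0 : 0 <= M by rewrite -lee_fin -IH; apply: integral_ge0 => x _; nonneg.
set c := 2 * (m2 * n%:R).
have c0 : 0 <= c by rewrite !mulr_ge0.
transitivity (\int[N01]_t ((t ^+ 4)%:E + c%:E * (t ^+ 2)%:E + M%:E))%E.
  apply: eq_integral => t _.
  transitivity (\int[gauss n]_x ((t ^+ 4)%:E + (2 * t ^+ 2)%:E * (dotv x x)%:E
      + (dotv x x ^+ 2)%:E))%E.
    apply: eq_integral => x _; rewrite dotvv_vcons -EFinM -!EFinD; congr EFin; ring.
  rewrite ge0_integralD//; side; last first.
    by apply: emeasurable_funD => //; side.
  rewrite ge0_integralD//; side.
  rewrite ge0_integralZl//; side.
  rewrite integral_gauss_sqnorm IH integral_probability_cst.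
  by rewrite -!EFinM -!EFinD; congr EFin; rewrite /c; ring.
rewrite ge0_integralD//; side; last first.
  by apply: emeasurable_funD; [exact: mX | apply: measurable_funeM; exact: mX].
rewrite ge0_integralD//; side.
rewrite ge0_integralZl//; side.
rewrite gmoment2E gmoment4E integral_normal_cst -EFinM -!EFinD.
by congr EFin; rewrite /M /c -natr1; ring.
Qed.

(** The exact variance is [n (m4 - m2 ^+ 2)]; the negative part is dropped. *)
Lemma gauss_sqnorm_variance n :
  (\int[gauss n]_x ((dotv x x - m2 * n%:R) ^+ 2)%:E <= (m4 * n%:R)%:E)%E.
Proof.
set c := 2 * (m2 * n%:R).
have c0 : 0 <= c by rewrite !mulr_ge0.
have mdev : measurable_fun [set: vec R n] (fun x => ((dotv x x - m2 * n%:R) ^+ 2)%:E).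
  apply/measurable_EFinP; apply: measurable_funX; apply: measurable_funB => //.
  exact: measurable_dotvv.
(* The cross term of the square is moved to the left so that every integrand is nonnegative. *)
have : (\int[gauss n]_x (((dotv x x - m2 * n%:R) ^+ 2)%:E + c%:E * (dotv x x)%:E) =
    \int[gauss n]_x ((dotv x x ^+ 2)%:E + ((m2 * n%:R) ^+ 2)%:E))%E.
  by apply: eq_integral => x _; rewrite -EFinM -!EFinD; congr EFin; rewrite /c; ring.
rewrite ge0_integralD//; side.
rewrite ge0_integralZl//; side.
rewrite integral_gauss_sqnorm ge0_integralD//; side.
rewrite integral_gauss_sqnorm2 integral_probability_cst -EFinM -EFinD.
move=> h; rewrite -(@leeD2rE _ (c * (m2 * n%:R))%:E)// h -EFinD lee_fin.
have : 0 <= m2 ^+ 2 * n%:R by rewrite mulr_ge0// sqr_ge0.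
by rewrite /c; lra.
Qed.

Lemma gauss_sqnorm_mgf n :
  (\int[@gauss R n]_x (expR (dotv x x / 4))%:E = ((Num.sqrt 2 : R) ^+ n)%:E)%E.
Proof.
elim: n => [|n IH].
  by rewrite integral_gauss0// /dotv big_ord0 mul0r expR0.
rewrite integral_gaussS//; side.
transitivity (\int[N01]_t ((Num.sqrt 2 ^+ n)%:E * (expR (t ^+ 2 / 4))%:E))%E.
  apply: eq_integral => t _.
  under eq_integral do rewrite dotvv_vcons mulrDl expRD EFinM.
  by rewrite ge0_integralZl//; side; rewrite IH muleC.
rewrite ge0_integralZl//; side.
by rewrite gauss_mgf -EFinM mulrC exprS.
Qed.

Lemma measurable_sqnorm_gt n (c : R) : measurable [set x : vec R n | c < dotv x x].
Proof.
have -> : [set x : vec R n | c < dotv x x] =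
    (fun x : vec R n => dotv x x) @^-1` `]c, +oo[%classic.
  by apply/seteqP; split => z /=; rewrite in_itv/= andbT.
rewrite -[X in measurable X]setTI; apply: measurable_dotvv => //.
Qed.

(** A Chernoff bound at exponent [1 / 4]: the threshold contributes [expR (- n)], the moment
    generating function [sqrt 2 ^+ n], and [sqrt 2 <= expR (1 / 2)]. *)
Lemma gauss_sqnorm_tail n :
  (@gauss R n [set x | (4 * n%:R < dotv x x)%R] <= (expR (- (n%:R / 2)))%:E)%E.
Proof.
have mA := @measurable_sqnorm_gt n (4 * n%:R).
rewrite -[X in gauss n X]setIT -integral_indic//.
apply: (@le_trans _ _ (\int[gauss n]_x ((expR (- n%:R))%:E * (expR (dotv x x / 4))%:E)))%E.
  apply: ge0_le_integral => //; side.
    by apply/measurable_EFinP; exact: measurable_indic.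
  move=> x _; rewrite indicE -EFinM -expRD; case: (boolP (x \in _)); last by nonneg.
  rewrite inE/= => nx; rewrite lee_fin -[leLHS]expR0 ler_expR; lra.
rewrite ge0_integralZl//; side.
rewrite gauss_sqnorm_mgf -EFinM lee_fin.
have s2 : Num.sqrt 2 <= expR (1 / 2) :> R.
  rewrite -(@ler_pXn2r _ 2)// ?nnegrE ?expR_ge0 ?sqrtr_ge0// sqr_sqrtr// -expRM_natl.
  by have := @expR_ge1Dx R (2%:R * (1 / 2)); lra.
have -> : - (n%:R / 2) = - n%:R + n%:R * (1 / 2) :> R by field.
rewrite expRD ler_pM2l ?expR_gt0// expRM_natl; apply: lerXn2r => //.
  by rewrite nnegrE sqrtr_ge0.
by rewrite nnegrE expR_ge0.
Qed.

End gaussian_norm.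

(** * Random subfamilies of slabs and membership queries *)

Section random_subfamily.
Context {R : realType} {V : Type} {I : finType} (a : I -> V -> bool) (c : R).
Hypothesis c01 : 0 <= c <= 1.
Local Notation W := {ffun I -> bool}.
Implicit Types (w : W) (x y : V).

(** The product Bernoulli law of a random subfamily. *)
Definition weight w : R := \prod_i (if w i then c else 1 - c).

(** With [a i y] read as violation of constraint [i] at [y], this is membership in the body, hence
    the oracle's answer. *)
Definition avoids w y : bool := ~~ [exists i, w i && a i y].

Definition restrict_off x w : W := [ffun i => w i && ~~ a i x].

Lemma weight_ge0 w : 0 <= weight w.
Proof.
case/andP: c01 => c0 c1; apply: prodr_ge0 => i _.
by case: (w i) => //; rewrite subr_ge0.
Qed.

Lemma sum_weight : \sum_w weight w = 1.
Proof.
rewrite /weight -(bigA_distr_bigA (fun (_ : I) (b : bool) => if b then c else 1 - c)).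
by rewrite big1// => i _; rewrite big_bool/= addrC subrK.
Qed.

(** Each constraint violated at [x] must be absent, which happens independently with probability
    [1 - c]. *)
Lemma sum_weight_avoids x :
  \sum_w weight w * (avoids w x)%:R = (1 - c) ^+ #|[pred i | a i x]|.
Proof.
pose F (i : I) (b : bool) : R := if b then (if a i x then 0 else c) else 1 - c.
transitivity (\sum_(w : W) \prod_i F i (w i)).
  apply: eq_bigr => w _; rewrite /avoids; case: (boolP [exists i, _]) => [|/existsPn h].
    move=> /existsP[i /andP[wi ai]]; rewrite mulr0 (bigD1 i)//= /F wi ai mul0r//.
  rewrite mulr1; apply: eq_bigr => i _; rewrite /F.
  by case: (boolP (w i)) => // wi; have := h i; rewrite wi/= => /negbTE ->.
rewrite -bigA_distr_bigA -prodr_const [RHS]big_mkcond/=; apply: eq_bigr => i _.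
by rewrite big_bool/= /F inE; case: (a i x); rewrite ?add0r// addrC subrK.
Qed.

(* Resampling the members of the family that are not violated by [x] shows that
   the violated and the non-violated parts of the subfamily are independent. *)
Lemma sum_weight_indep x (G : W -> R) :
  \sum_w weight w * (G (restrict_off x w) * (avoids w x)%:R) =
  (\sum_w weight w * G (restrict_off x w)) * (\sum_w weight w * (avoids w x)%:R).
Proof.
pose mix w w' : W := [ffun i => if a i x then w i else w' i].
pose swap (p : W * W) := (mix p.1 p.2, mix p.2 p.1).
have swapK : involutive swap.
  by move=> [w w']; congr (_, _); apply/ffunP => i; rewrite !ffunE; case: (a i x).
have weight_mix w w' : weight (mix w w') * weight (mix w' w) = weight w * weight w'.
  rewrite /weight -!big_split; apply: eq_bigr => i _.
  by rewrite !ffunE; case: (a i x) => //=; exact: mulrC.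
have restr_mix w w' : restrict_off x (mix w w') = restrict_off x w'.
  by apply/ffunP => i; rewrite !ffunE; case: (a i x) => //; rewrite !andbF.
have avoids_mix w w' : avoids (mix w w') x = avoids w x.
  congr (~~ _); apply: eq_existsb => i; rewrite ffunE.
  by case: (a i x) => //; rewrite !andbF.
rewrite big_distrlr pair_bigA/= (reindex_inj (inv_inj swapK))/=.
transitivity (\sum_(p : W * W) weight p.1 * (weight p.2 * (G (restrict_off x p.2) * (avoids p.2 x)%:R))).
  rewrite -(pair_bigA _ (fun w w' => weight w * (weight w' * (G (restrict_off x w') * (avoids w' x)%:R))))/=.
  by rewrite -big_distrlr/= sum_weight mul1r.
apply: eq_bigr => -[w w'] _ /=; rewrite restr_mix avoids_mix mulrACA weight_mix.
by rewrite mulrACA mulrA mulrACA !mulrA.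
Qed.

(** By induction on the transcript. A positive answer persists because removing constraints enlarges
    the body; a negative one persists because the picked violated constraint is satisfied at [x] and
    so is kept. *)
Lemma answers_restrict x w (q : seq bool -> V) k :
  (forall j i, (j < k)%N ->
     [pick i | w i && a i (q (answers (avoids w) q j))] = Some i -> ~~ a i x) ->
  answers (avoids (restrict_off x w)) q k = answers (avoids w) q k.
Proof.
elim: k => //= k IH h; rewrite IH; last by move=> j i jk; apply: h; rewrite ltnS ltnW.
congr rcons; have := h k; move: (q _) => y.
rewrite /avoids; case: pickP => [i /andP[wi ai]|h0] hk; congr negb.
  have nx : ~~ a i x by apply: hk.
  apply/existsP/existsP => _; first by exists i; rewrite wi.
  by exists i; rewrite ffunE wi nx.
apply/existsP/existsP => -[i]; last by rewrite h0.
by rewrite ffunE => /andP[/andP[wi _] ai]; have := h0 i; rewrite wi ai.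
Qed.

(** Each negative answer is charged to one present violated constraint, and the charges violated at
    [x] are counted. The charged constraint is chosen without reference to [x], so a bound for each
    fixed constraint suffices; a positive answer charges nothing. *)
Definition hits x w (q : seq bool -> V) k : R :=
  \sum_(j < k) (oapp (a^~ x) false [pick i | w i && a i (q (answers (avoids w) q j))])%:R.

(** The output computed from the restricted subfamily is independent of membership of [x]. It
    differs from the actual output only if some charged constraint is violated at [x], and then
    [hits] is at least 1. *)
Lemma query_error_ge x (q : seq bool -> V) (h : seq bool -> bool) k :
  1 / 2 - `|(1 - c) ^+ #|[pred i | a i x]| - 1 / 2| <=
  \sum_w weight w * (h (answers (avoids w) q k) != avoids w x)%:R +
  \sum_w weight w * hits x w q k.
Proof.
pose G w : R := (h (answers (avoids w) q k))%:R.
pose e := \sum_w weight w * G (restrict_off x w).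
have e0 : 0 <= e by apply: sumr_ge0 => w _; rewrite mulr_ge0// weight_ge0.
have e1 : e <= 1.
  rewrite -sum_weight; apply: ler_sum => w _; rewrite ler_piMr ?weight_ge0//.
  by rewrite /G; case: (h _).
rewrite -sum_weight_avoids; set p := \sum_w weight w * (avoids w x)%:R.
(* This is the probability that independent bits of means [e] and [p] differ, equal to
   [1 / 2 - 2 (e - 1 / 2) (p - 1 / 2)]. *)
apply: (@le_trans _ _ (e + p - 2 * (e * p))).
  have [p2|p2] := ger0P (p - 1 / 2); nra.
rewrite /e /p -sum_weight_indep -!big_split mulr_sumr -sumrB/=.
apply: ler_sum => w _.
have -> : weight w * G (restrict_off x w) + weight w * (avoids w x)%:R -
    2 * (weight w * (G (restrict_off x w) * (avoids w x)%:R)) = weight w *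
    (G (restrict_off x w) + (avoids w x)%:R - 2 * (G (restrict_off x w) * (avoids w x)%:R)) by ring.
rewrite -mulrDr ler_wpM2l ?weight_ge0//.
have H0 : 0 <= hits x w q k by apply: sumr_ge0.
have [H1|H1] := leP 1 (hits x w q k).
  have : G (restrict_off x w) + (avoids w x)%:R - 2 * (G (restrict_off x w) * (avoids w x)%:R) <= 1.
    by rewrite /G; case: (h _); case: (avoids _ _) => /=; lra.
  by case: (_ != _) => /=; lra.
rewrite /G answers_restrict; last first.
  move=> j i jk pi; apply: contraT; rewrite negbK => ai; move: H1.
  rewrite /hits (bigD1 (Ordinal jk))//= pi/= ai ltNge lerDl.
  by rewrite sumr_ge0.
by case: (h _); case: (avoids _ _) => /=; lra.
Qed.

End random_subfamily.

(** * A deterministic family with balanced violation counts *)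

Section greedy_selection.
Context d d' (T : measurableType d) (X : measurableType d') (R : realType).
Variables (P : probability T R) (Q : probability X R) (A : set (T * X)).
Hypothesis mA : measurable A.

(** The slack 1 makes the averaging argument immediate: otherwise [F] exceeds [c + 1] everywhere,
    and so does its mean at least weakly. *)
Lemma exists_le_integral (F : T -> \bar R) (c : R) :
  measurable_fun [set: T] F -> (forall v, 0 <= F v)%E ->
  (\int[P]_v F v <= c%:E)%E -> exists v, (F v <= (c + 1)%:E)%E.
Proof.
move=> mF F0 Fc.
have c0 : 0 <= c by rewrite -lee_fin; apply: le_trans Fc; exact: integral_ge0.
apply: contrapT => /forallNP h.
have : ((c + 1)%:E <= \int[P]_v F v)%E.
  rewrite -(integral_probability_cst P (c + 1)%:E).
  apply: ge0_le_integral => //.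
  - by move=> v _; rewrite lee_fin addr_ge0.
  - by move=> v _; apply: ltW; rewrite ltNge; apply/negP/h.
by move=> /le_trans/(_ Fc); rewrite lee_fin; lra.
Qed.

Definition slice_prob (x : X) : R := fine (P (ysection A x)).

Let mslice x : measurable (ysection A x). Proof. exact: measurable_ysection. Qed.

Lemma slice_probE x : P (ysection A x) = (slice_prob x)%:E.
Proof. by rewrite fineK// fin_num_measure. Qed.

Lemma slice_prob_ge0 x : 0 <= slice_prob x.
Proof. exact: fine_ge0. Qed.

Lemma slice_prob_le1 x : slice_prob x <= 1.
Proof. by rewrite -lee_fin -slice_probE probability_le1. Qed.

Lemma measurable_slice_prob : measurable_fun [set: X] slice_prob.
Proof.
apply: (@measurableT_comp _ _ _ _ _ _ fine) => //.
exact: (measurable_fun_ysection P mA).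
Qed.

Let ind (v : T) (x : X) : R := \1_A (v, x).

Let mind v : measurable_fun [set: X] (ind v).
Proof.
have m1A : measurable_fun [set: T * X] (\1_A : T * X -> R) by exact: measurable_indic.
exact: (measurableT_comp m1A (measurable_pair1 v)).
Qed.

(** The centred indicator has mean 0, so the cross term vanishes and the Bernoulli variance is
    added. *)
Lemma integral_slice_sqr (x : X) (D : R) :
  (\int[P]_v ((D + (\1_A (v, x) - slice_prob x)) ^+ 2)%:E =
   (D ^+ 2 + slice_prob x * (1 - slice_prob x))%:E)%E.
Proof.
set p := slice_prob x.
(* The integrand takes two values, one on the section and one off it; this form involves only
   nonnegative terms. *)
transitivity (\int[P]_v (((D - p) ^+ 2)%:E * (\1_(~` ysection A x) v)%:E +
    ((D - p + 1) ^+ 2)%:E * (\1_(ysection A x) v)%:E))%E.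
  apply: eq_integral => v _; rewrite -!EFinM -EFinD; congr EFin.
  rewrite !indicE in_setC mem_ysection; case: (_ \in _) => /=; ring.
have mI (B : set T) : measurable B -> measurable_fun [set: T] (fun v => (\1_B v : R)%:E).
  by move=> mB; apply/measurable_EFinP; exact: measurable_indic.
rewrite ge0_integralD//; try nonneg; try (apply: measurable_funeM; apply: mI => //; exact: measurableC).
rewrite !ge0_integralZl//; try nonneg; try (apply: mI => //; exact: measurableC).
rewrite !integral_indic// ?setIT; last exact: measurableC.
rewrite /= probability_setC// slice_probE -EFinB -!EFinM -EFinD; congr EFin.
rewrite -/p; ring.
Qed.

(** Greedy derandomization: a random new element raises the mean square by at most 1 on average, and
    fixing a good one costs the slack 1 of [exists_le_integral], whence 2 per element. *)
Lemma exists_balanced_family N : exists v : nat -> T,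
  (\int[Q]_x ((\sum_(i < N) (\1_A (v i, x) - slice_prob x)) ^+ 2)%:E <= (2 * N%:R)%:E)%E.
Proof.
elim: N => [|N [v IH]].
  exists (fun=> point); rewrite (eq_integral (cst 0%E)) ?integral0 ?mulr0//.
  by move=> x _; rewrite big_ord0 expr0n.
pose D x : R := \sum_(i < N) (\1_A (v i, x) - slice_prob x).
have mD : measurable_fun [set: X] D.
  apply: measurable_sum => i; apply: measurable_funB; [exact: mind | exact: measurable_slice_prob].
pose g (p : T * X) : \bar R := ((D p.2 + (\1_A p - slice_prob p.2)) ^+ 2)%:E.
have mg : measurable_fun [set: T * X] g.
  apply/measurable_EFinP; apply: measurable_funX; apply: measurable_funD.
    exact: (measurableT_comp mD measurable_snd).
  apply: measurable_funB; first exact: measurable_indic.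
  exact: (measurableT_comp measurable_slice_prob measurable_snd).
have g0 p : (0 <= g p)%E by rewrite lee_fin sqr_ge0.
have mD2 : measurable_fun [set: X] (fun x => (D x ^+ 2)%:E).
  by apply/measurable_EFinP; exact: measurable_funX.
have : (\int[P]_v \int[Q]_x g (v, x) <= (2 * N%:R + 1)%:E)%E.
  rewrite (fubini_tonelli (m1 := P) (m2 := Q) g)//.
  apply: (@le_trans _ _ (\int[Q]_x ((D x ^+ 2)%:E + 1))%E); last first.
    rewrite ge0_integralD//; try nonneg.
    by rewrite integral_probability_cst EFinD leeD2r.
  apply: ge0_le_integral => //; try nonneg.
  - by move=> x _; apply: integral_ge0.
  - exact: (measurable_fun_fubini_tonelli_G (m1 := P) g).
  - by apply: emeasurable_funD.
  move=> x _; rewrite /g/= integral_slice_sqr -EFinD lee_fin lerD2l.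
  have := slice_prob_ge0 x; have := slice_prob_le1 x; nra.
move=> /exists_le_integral[||v' hv'].
- exact: (measurable_fun_fubini_tonelli_F (m2 := Q) g).
- by move=> ?; apply: integral_ge0.
exists (fun i => if (i < N)%N then v i else v').
apply: le_trans (_ : ((2 * N%:R + 1 + 1)%:E <= _)%E); last first.
  by rewrite lee_fin -natr1; lra.
apply: le_trans hv'; rewrite le_eqVlt; apply/orP; left; apply/eqP.
apply: eq_integral => x _; rewrite big_ord_recr/= ltnn /g/=; congr ((_ + _) ^+ 2)%:E.
by apply: eq_bigr => i _; rewrite ltn_ord.
Qed.

End greedy_selection.

(** * Finite laws as probability measures *)

Section finite_probability.
Context {R : realType} (W : finType) (w0 : W) (p : W -> R).
Hypotheses (p0 : forall w, 0 <= p w) (p1 : \sum_w p w = 1).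

(** The law is carried by [nat] through the enumeration of [W]. Indices from [#|W|] on decode to
    [w0] and have no mass. *)
Definition decode (k : nat) : W := nth w0 (enum W) k.

Definition fin_prob := msum (fun k => mscale (NngNum (p0 (decode k))) (@dirac _ nat k R)) #|W|.

HB.instance Definition _ := Measure.on fin_prob.

Lemma integral_fin_prob (F : W -> \bar R) : (forall w, 0 <= F w)%E ->
  (\int[fin_prob]_k F (decode k) = \sum_w (p w)%:E * F w)%E.
Proof.
move=> F0; rewrite ge0_integral_measure_sum//.
transitivity (\sum_(k < #|W|) (p (decode k))%:E * F (decode k))%E.
  apply: eq_bigr => k _; rewrite ge0_integral_mscale//= integral_dirac//.
  by rewrite diracT mul1e.
rewrite -(big_mkord xpredT (fun k => (p (decode k))%:E * F (decode k))%E) cardE.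
by rewrite -(big_nth w0 xpredT (fun w => (p w)%:E * F w)%E) big_enum.
Qed.

Lemma fin_prob_setT : fin_prob [set: nat] = 1%E.
Proof.
rewrite -[LHS]mul1e -(@integral_cst _ _ _ fin_prob _ measurableT 1%E).
rewrite (integral_fin_prob (F := fun=> 1%E))//.
by under eq_bigr do rewrite mule1; rewrite sumEFin p1.
Qed.

End finite_probability.

(** * Measurability of Boolean events *)

Section boolean_measurability.
Context d (T : measurableType d) {R : realType}.

Let mem_setb (b : T -> bool) x : (x \in [set x | b x]) = b x.
Proof. by apply/idP/idP; rewrite inE. Qed.

Lemma measurable_natr_bool (b : T -> bool) :
  measurable [set x | b x] -> measurable_fun [set: T] (fun x => (b x)%:R : R).
Proof.
move=> mb; rewrite (_ : (fun x => _) = \1_[set x | b x]); first exact: measurable_indic.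
by apply/funext => x; rewrite indicE mem_setb.
Qed.

Lemma integral_natr_bool (P : probability T R) (b : T -> bool) :
  measurable [set x | b x] -> (\int[P]_x (b x)%:R%:E = P [set x | b x])%E.
Proof.
move=> mb; rewrite -[in RHS](setIT [set x | b x]) -integral_indic//.
by apply: eq_integral => x _; rewrite indicE mem_setb.
Qed.

Lemma measurable_neqb (b b' : T -> bool) : measurable [set x | b x] ->
  measurable [set x | b' x] -> measurable [set x | b x != b' x].
Proof.
move=> mb mb'.
rewrite (_ : [set x | b x != b' x] =
  ([set x | b x] `\` [set x | b' x]) `|` ([set x | b' x] `\` [set x | b x])).
  by apply: measurableU; exact: measurableD.
apply/seteqP; split => x /=; case: (b x); case: (b' x) => //=.
- by left.
- by right.
- by case=> -[].
- by case=> -[].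
Qed.

Lemma measurable_negb (b : T -> bool) :
  measurable [set x | b x] -> measurable [set x | ~~ b x].
Proof.
move=> mb; rewrite (_ : [set x | ~~ b x] = ~` [set x | b x]); first exact: measurableC.
by apply/seteqP; split => x /= /negP.
Qed.

End boolean_measurability.

(** * From the pointwise inequality to the error of a randomized algorithm *)

Section query_lower_bound.
Context {R : realType} (n : nat) (I : finType) (a : I -> vec R n -> bool) (c : R).
Hypothesis c01 : 0 <= c <= 1.
Hypothesis ma : forall i, measurable [set x | a i x].
Local Notation W := {ffun I -> bool}.
Local Notation dec := (decode ([ffun=> false] : W)).

Definition query_law := fin_prob ([ffun=> false] : W) (weight_ge0 c01).

HB.instance Definition _ := Measure.on query_law.

HB.instance Definition _ := Measure_isProbability.Build _ _ _ query_law
  (fin_prob_setT ([ffun=> false] : W) (weight_ge0 c01) (sum_weight c)).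

Lemma measurable_avoids w : measurable [set x | avoids a w x].
Proof.
apply: measurable_negb.
rewrite (_ : [set x | _] = \bigcup_(i in [set i | w i]) [set x | a i x]).
  by apply: fin_bigcup_measurable => //; exact: finite_finset.
apply/seteqP; split => x /=.
  by move=> /existsP[i /andP[wi ai]]; exists i.
by move=> [i /= wi ai]; apply/existsP; exists i; rewrite wi.
Qed.

Section algorithm.
Context d (U : measurableType d) (q : U -> seq bool -> vec R n).
Hypothesis mq : forall b, measurable_fun [set: U] (fun u => q u b).

Lemma measurable_answers w k b : measurable [set u | answers (avoids a w) (q u) k = b].
Proof.
elim: k b => [|k IH] b /=.
  have [->|b0] := eqVneq b [::].
    by rewrite (_ : [set u | _] = setT)//; apply/seteqP; split.
  rewrite (_ : [set u | _] = set0)//; apply/seteqP; split => // u /= b0'.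
  by move: b0; rewrite -b0'.
case/lastP: b => [|b t].
  rewrite (_ : [set u | _] = set0)//; apply/seteqP; split => // u /=.
  by case: (answers _ _ _).
(* Once the first [k] answers are fixed to [b], the next query is the measurable map [u |-> q u b],
   although queries are adaptive. *)
rewrite (_ : [set u | _] = [set u | answers (avoids a w) (q u) k = b] `&`
   (fun u => q u b) @^-1` [set y | avoids a w y = t]).
  apply: measurableI => //; rewrite -[X in measurable X]setTI; apply: mq => //.
  case: t; first exact: measurable_avoids.
  rewrite (_ : [set y | _] = [set y | ~~ avoids a w y]).
    by apply: measurable_negb; exact: measurable_avoids.
  by apply/seteqP; split => y /=; case: (avoids _ _ _).
apply/seteqP; split => u /=.
  by move=> /eqP; rewrite eqseq_rcons => /andP[/eqP <- /eqP].
by move=> [-> ->].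
Qed.

Lemma measurable_error w k (h : U -> seq bool -> vec R n -> bool) :
  (forall b, measurable [set p : U * vec R n | h p.1 b p.2]) ->
  measurable [set p : U * vec R n |
    h p.1 (answers (avoids a w) (q p.1) k) p.2 != avoids a w p.2].
Proof.
move=> mh; apply: measurable_neqb; last first.
  rewrite -[X in measurable X]setTI.
  apply: (measurable_snd measurableT [set x | avoids a w x]).
  exact: measurable_avoids.
(* There are countably many transcripts, and the hypothesis is jointly measurable for each fixed
   one. *)
rewrite (_ : [set p | _] = \bigcup_(b : seq bool)
  (([set u | answers (avoids a w) (q u) k = b] `*` [set: vec R n]) `&`
   [set p : U * vec R n | h p.1 b p.2])).
  apply: countable_bigcupT_measurable => // b.
  by apply: measurableI => //; apply: measurableX => //; exact: measurable_answers.
apply/seteqP; split => -[u x] /=.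
  by move=> hux; exists (answers (avoids a w) (q u) k).
by move=> [b _ [[/= <- _]]].
Qed.

End algorithm.

Definition query_body (k : nat) : set (vec R n) := [set x | avoids a (dec k) x].

Lemma measurable_query_body : measurable [set p : nat * vec R n | query_body p.1 p.2].
Proof.
rewrite (_ : [set p | _] = \bigcup_(k : nat) ([set k] `*` query_body k)).
  apply: bigcupT_measurable => k; apply: measurableX => //.
  exact: measurable_avoids.
apply/seteqP; split => -[k x] /=; first by exists k.
by move=> [k' _ [/= ->]].
Qed.

(** For each seed [u] and subfamily [w], [query_error_ge] is averaged over the test point: each of
    the [s] charges costs at most [p], and the imbalance at most [e]. *)
Lemma mq_error_ge (p e : R) (E : vec R n -> R) d (U : measurableType d)
    (Q : probability U R) (q : U -> seq bool -> vec R n)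
    (h : U -> seq bool -> vec R n -> bool) (s : nat) :
  (forall b, measurable_fun setT (fun u => q u b)) ->
  (forall b, measurable [set p : U * vec R n | h p.1 b p.2]) ->
  0 <= p -> (forall i, gauss n [set x | a i x] <= p%:E)%E ->
  measurable_fun [set: vec R n] E ->
  (forall x, `|(1 - c) ^+ #|[pred i | a i x]| - 1 / 2| <= E x) ->
  (\int[gauss n]_x (E x)%:E <= e%:E)%E ->
  ((1 / 2 - (s%:R * p + e))%:E <= mq_error query_law query_body Q q h s)%E.
Proof.
move=> mq mh p0 ap mE hE Ee.
have E0 x : 0 <= E x by apply: le_trans (hE x).
pose err w (u : U) x : R := (h u (answers (avoids a w) (q u) s) x != avoids a w x)%:R.
have merr w u : measurable_fun [set: vec R n] (fun x => (err w u x)%:E).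
  apply/measurable_EFinP; apply: measurable_natr_bool.
  have := measurable_error mq w s mh.
  move=> /(measurable_xsection u); congr (measurable _).
  by apply/seteqP; split => x /=; rewrite /xsection/= inE.
have merr2 w : measurable_fun [set: U * vec R n] (fun p => (err w p.1 p.2)%:E).
  apply/measurable_EFinP; exact: (measurable_natr_bool
    (b := fun p => h p.1 (answers (avoids a w) (q p.1) s) p.2 != avoids a w p.2)
    (measurable_error mq w s mh)).
have errE : (mq_error query_law query_body Q q h s =
    \sum_w (weight c w)%:E * \int[Q]_u \int[gauss n]_x (err w u x)%:E)%E.
  rewrite -(integral_fin_prob ([ffun=> false] : W) (weight_ge0 c01)
    (F := fun w => \int[Q]_u \int[gauss n]_x (err w u x)%:E)%E); last first.
    by move=> w; apply: integral_ge0 => u _; apply: integral_ge0 => x _; rewrite lee_fin.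
  apply: eq_integral => k _; apply: eq_integral => u _.
  rewrite -gauss_expectE//; try by move=> x; rewrite lee_fin.
  congr (gauss_expect _); apply/funext => x; congr (_%:R%:E).
  rewrite /query_body (_ : (fun y => `[< _ >]) = avoids a (dec k)); last first.
    by apply/funext => y; rewrite asboolb.
  by rewrite asboolb.
have mG w : measurable_fun [set: U] (fun u => \int[gauss n]_x (err w u x)%:E)%E.
  have err0 (r : U * vec R n) : (0 <= (err w r.1 r.2)%:E)%E by rewrite lee_fin.
  exact: (measurable_fun_fubini_tonelli_F (m2 := gauss n) _ (merr2 w) err0).
have G0 w u : (0 <= \int[gauss n]_x (err w u x)%:E)%E.
  by apply: integral_ge0 => x _; rewrite lee_fin.
have wt0 (w : W) : (0 <= (weight c w)%:E)%E by rewrite lee_fin weight_ge0.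
rewrite errE.
have -> : (\sum_w (weight c w)%:E * \int[Q]_u \int[gauss n]_x (err w u x)%:E =
    \int[Q]_u \sum_w ((weight c w)%:E * \int[gauss n]_x (err w u x)%:E))%E.
  rewrite ge0_integral_sum//.
  - by apply: eq_bigr => w _; rewrite ge0_integralZl.
  - by move=> w; exact: measurable_funeM.
  - by move=> w u _; rewrite mule_ge0.
(* A nonpositive bound is trivial; otherwise it is a nonnegative constant, and the seeds can be
   treated one by one. *)
have [neg|pos] := leP (1 / 2 - (s%:R * p + e)) 0.
  apply: (@le_trans _ _ 0%E); first by rewrite lee_fin.
  by apply: integral_ge0 => u _; apply: sume_ge0 => w _; rewrite mule_ge0.
rewrite -(integral_probability_cst Q (1 / 2 - _)%:E).
apply: ge0_le_integral => //.
- by move=> u _; rewrite lee_fin ltW.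
- by apply: emeasurable_sum => w; exact: measurable_funeM.
move=> u _.
pose hit w x : R := hits a x w (q u) s.
have hit0 w x : 0 <= hit w x by apply: sumr_ge0.
have mhitj (w : W) (j : 'I_s) : measurable [set x |
    oapp (a^~ x) false [pick i | w i && a i (q u (answers (avoids a w) (q u) j))]].
  by case: pickP => [i _|_] //=; rewrite (_ : [set x | _] = set0)//; apply/seteqP; split.
have mhit w : measurable_fun [set: vec R n] (fun x => (hit w x)%:E).
  apply/measurable_EFinP; apply: measurable_sum => j.
  exact: measurable_natr_bool.
(* With [w] and [u] fixed, the constraint charged at each step does not depend on [x]. *)
have hit_le w : (\int[gauss n]_x (hit w x)%:E <= (s%:R * p)%:E)%E.
  rewrite /hit /hits; under eq_integral do rewrite -sumEFin.
  rewrite ge0_integral_sum//; last by move=> j; apply/measurable_EFinP; exact: measurable_natr_bool.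
  apply: (@le_trans _ _ (\sum_(j < s) p%:E)%E); last first.
    by rewrite sumEFin sumr_const card_ord mulr_natl lexx.
  apply: lee_sum => j _; rewrite integral_natr_bool//.
  case: pickP => [i _|_]; first exact: ap.
  by rewrite (_ : [set x | _] = set0) ?measure0//; apply/seteqP; split.
(* All losses stand on the larger side, so only nonnegative functions are integrated. *)
have key x : 1 / 2 <= \sum_w weight c w * err w u x + \sum_w weight c w * hit w x + E x.
  have := query_error_ge a c01 x (q u) (fun b => h u b x) s.
  by have := hE x; rewrite /err /hit; lra.
have mwerr w : measurable_fun [set: vec R n] (fun x => ((weight c w)%:E * (err w u x)%:E)%E).
  exact: measurable_funeM.
have mwhit w : measurable_fun [set: vec R n] (fun x => ((weight c w)%:E * (hit w x)%:E)%E).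
  exact: measurable_funeM.
have werr0 w x : (0 <= (weight c w)%:E * (err w u x)%:E)%E by rewrite mule_ge0// lee_fin.
have whit0 w x : (0 <= (weight c w)%:E * (hit w x)%:E)%E by rewrite mule_ge0// lee_fin.
have mE' : measurable_fun [set: vec R n] (fun x => (E x)%:E) by exact/measurable_EFinP.
have mS1 : measurable_fun [set: vec R n]
    (fun x => \sum_w ((weight c w)%:E * (err w u x)%:E))%E by exact: emeasurable_sum.
have mS2 : measurable_fun [set: vec R n]
    (fun x => \sum_w ((weight c w)%:E * (hit w x)%:E))%E by exact: emeasurable_sum.
have : ((1 / 2)%:E <= \int[gauss n]_x
    (\sum_w ((weight c w)%:E * (err w u x)%:E) +
     \sum_w ((weight c w)%:E * (hit w x)%:E) + (E x)%:E))%E.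
  rewrite -(integral_probability_cst (gauss n) (1 / 2)%:E).
  apply: ge0_le_integral => //.
  - by apply: emeasurable_funD => //; exact: emeasurable_funD.
  move=> x _; under eq_bigr do rewrite -EFinM.
  by under [X in (_ + X + _)%E]eq_bigr do rewrite -EFinM; rewrite !sumEFin -!EFinD lee_fin.
have S1_ge0 x : (0 <= \sum_w ((weight c w)%:E * (err w u x)%:E))%E by exact: sume_ge0.
have S2_ge0 x : (0 <= \sum_w ((weight c w)%:E * (hit w x)%:E))%E by exact: sume_ge0.
have mS12 := emeasurable_funD mS1 mS2.
have S12_ge0 x : [set: vec R n] x -> (0 <= \sum_w ((weight c w)%:E * (err w u x)%:E) +
    \sum_w ((weight c w)%:E * (hit w x)%:E))%E by rewrite adde_ge0.
rewrite (ge0_integralD _ measurableT S12_ge0 mS12 _ mE'); last by move=> x _; rewrite lee_fin.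
rewrite (ge0_integralD _ measurableT (fun x _ => S1_ge0 x) mS1 (fun x _ => S2_ge0 x) mS2).
rewrite !ge0_integral_sum//.
set S := (\sum_(w : W) ((weight c w)%:E * \int[gauss n]_x (err w u x)%:E))%E.
have -> : (\sum_(w : W) \int[gauss n]_x ((weight c w)%:E * (err w u x)%:E))%E = S.
  apply: eq_bigr => w _; rewrite ge0_integralZl//.
  by move=> x _; rewrite lee_fin.
have hS : (\sum_(w : W) \int[gauss n]_x ((weight c w)%:E * (hit w x)%:E) <= (s%:R * p)%:E)%E.
  apply: (@le_trans _ _ (\sum_(w : W) (weight c w)%:E * (s%:R * p)%:E)%E).
    apply: lee_sum => w _; rewrite ge0_integralZl//; try by move=> x _; rewrite lee_fin.
    exact: lee_wpmul2l.
  by under eq_bigr do rewrite -EFinM; rewrite sumEFin -mulr_suml sum_weight mul1r lexx.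
move=> /le_trans/(_ (leeD (leeD (le_refl S) hS) Ee)).
by rewrite -addeA -EFinD EFinB leeBlDr.
Qed.

End query_lower_bound.

(** * The hard distribution *)

Section hard_family.
Context {R : realType}.
Local Notation N01 := (@normal_prob R 0 1).
Local Notation m2 := (@gmoment R 2).
Local Notation m4 := (@gmoment R 4).

Lemma measurable_absdotv_gt n (x : vec R n) (th : R) :
  measurable [set v : vec R n | th < `|dotv v x|].
Proof.
rewrite -[X in measurable X]setTI.
under eq_fun do rewrite dotvC.
exact: (measurable_dotvl x measurableT (measurable_absgt th)).
Qed.

Lemma gauss_absdotv_gt n (x : vec R n) (th : R) :
  gauss n [set v | th < `|dotv v x|] = N01 [set z | th < Num.sqrt (dotv x x) * `|z|].
Proof.
have mf : measurable_fun [set: R] (fun y : R => ((th < `|y|)%R%:R : R)%:E).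
  by apply/measurable_EFinP; apply: measurable_natr_bool; exact: measurable_absgt.
rewrite -integral_natr_bool; last exact: measurable_absdotv_gt.
rewrite (integral_gauss_dotv x mf); last by move=> y; rewrite lee_fin.
under eq_integral do rewrite normrM (ger0_norm (sqrtr_ge0 _)).
apply: (integral_natr_bool (normal_prob 0 1)).
rewrite (_ : [set z | _] = (fun z : R => Num.sqrt (dotv x x) * z) @^-1` [set y | th < `|y|]).
  rewrite -[X in measurable X]setTI.
  have mM : measurable_fun [set: R] (fun z : R => Num.sqrt (dotv x x) * z).
    exact: measurable_funM.
  by apply: mM => //; exact: measurable_absgt.
by apply/seteqP; split => z /=; rewrite normrM (ger0_norm (sqrtr_ge0 _)).
Qed.

(* Slabs with an atypically long normal vector are discarded. *)
Definition slab_violated n (th : R) (v x : vec R n) : bool :=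
  (dotv v v <= 4 * n%:R) && (th < `|dotv v x|).

Lemma measurable_slab_violated2 n th :
  measurable [set p : vec R n * vec R n | slab_violated th p.1 p.2].
Proof.
rewrite (_ : [set p | _] = ((fun v : vec R n => dotv v v) \o fst) @^-1` `]-oo, 4 * n%:R] `&`
   (fun p => dotv p.1 p.2) @^-1` [set y | th < `|y|]).
  apply: measurableI; rewrite -[X in measurable X]setTI.
    have mc : measurable_fun [set: vec R n * vec R n] ((fun v : vec R n => dotv v v) \o fst).
      exact: (measurableT_comp (@measurable_dotvv R n) measurable_fst).
    exact: mc.
  by apply: measurable_dotv => //; exact: measurable_absgt.
apply/seteqP; split => -[v x] /=; rewrite /slab_violated in_itv/=.
  by move=> /andP[].
by move=> [-> ->].
Qed.

Lemma measurable_slab_violated n th (v : vec R n) : measurable [set x | slab_violated th v x].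
Proof.
have := measurable_xsection v (@measurable_slab_violated2 n th); congr (measurable _).
by apply/seteqP; split => x /=; rewrite /xsection/= inE.
Qed.

Lemma slab_violated_prob n t (v : vec R n) : (0 < n)%N -> 0 <= t ->
  (gauss n [set x | slab_violated (t * Num.sqrt (m2 * n%:R)) v x] <=
   (Num.sqrt 2 * expR (- (t ^+ 2 * m2 / 16)))%:E)%E.
Proof.
move=> n0 t0; set th := t * _.
have nR : 0 < n%:R :> R by rewrite ltr0n.
have m20 := @gmoment2_gt0 R.
have u0 : 0 <= t * Num.sqrt m2 / 2 by rewrite divr_ge0// mulr_ge0// sqrtr_ge0.
have -> : expR (- (t ^+ 2 * m2 / 16)) = expR (- ((t * Num.sqrt m2 / 2) ^+ 2 / 4)).
  by congr (expR (- _)); rewrite expr_div_n exprMn sqr_sqrtr ?ltW//; field.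
apply: le_trans (_ : (gtail (t * Num.sqrt m2 / 2))%:E <= _)%E; last first.
  by rewrite lee_fin gtail_le_exp.
have [vn|vn] := leP (dotv v v) (4 * n%:R); last first.
  rewrite (_ : [set x | _] = set0) ?measure0 ?lee_fin ?gtail_ge0//.
  by apply/seteqP; split => // x /=; rewrite /slab_violated leNgt vn.
rewrite (_ : [set x | _] = [set x | th < `|dotv x v|]); last first.
  by apply/seteqP; split => x /=; rewrite /slab_violated vn dotvC.
rewrite gauss_absdotv_gt -gtailE.
apply: le_measure; rewrite ?inE.
- have [v0|v0] := leP (Num.sqrt (dotv v v)) 0.
    have -> : Num.sqrt (dotv v v) = 0 by apply/eqP; rewrite eq_le v0 sqrtr_ge0.
    rewrite (_ : [set z | _] = set0)//; apply/seteqP; split => // z /=.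
    by rewrite mul0r ltNge mulr_ge0// sqrtr_ge0.
  rewrite (_ : [set z | _] = [set z | th / Num.sqrt (dotv v v) < `|z|]).
    exact: measurable_absgt.
  by apply/seteqP; split => z /=; rewrite ltr_pdivrMr// mulrC.
- exact: measurable_absgt.
move=> z /= hz.
have sq : Num.sqrt (dotv v v) <= 2 * Num.sqrt n%:R.
  have -> : 2 * Num.sqrt n%:R = Num.sqrt (4 * n%:R) :> R.
    by rewrite sqrtrM//; congr (_ * _); rewrite (_ : 4 = 2 ^+ 2) ?sqrtr_sqr ?ger0_norm//; ring.
  by rewrite ler_wsqrtr.
have sn : 0 < Num.sqrt n%:R :> R by rewrite sqrtr_gt0.
have : th < 2 * Num.sqrt n%:R * `|z| by apply: lt_le_trans hz _; rewrite ler_wpM2r.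
rewrite /th sqrtrM ?ltW// => hz2.
rewrite -(ltr_pM2r sn); lra.
Qed.

(** This replaces first absolute moments by second moments; with [k = sqrt n], a mean square of
    order [1 / n] yields [O(1 / sqrt n)]. *)
Lemma abs_le_amgm (k u : R) : 0 < k -> `|u| <= (k * u ^+ 2 + k^-1) / 2.
Proof.
move=> k0; rewrite -(real_normK (num_real u)).
have kV : 0 < k^-1 by rewrite invr_gt0.
have : 0 <= k^-1 * (k * `|u| - 1) ^+ 2 by rewrite mulr_ge0 ?sqr_ge0// ltW.
have -> : k^-1 * (k * `|u| - 1) ^+ 2 = k * `|u| ^+ 2 + k^-1 - 2 * `|u|.
  by field; rewrite gt_eqF.
lra.
Qed.

(** The terms account for the fluctuation of the violation count, the discarded long normals, and
    the fluctuation of the squared norm of [x]. *)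
Definition error_bound n (t : R) : R :=
  3 / 2 * (Num.sqrt n%:R)^-1 + expR (- (n%:R / 2)) / gtail t
  + 2 * expR 3 * (1 + m4 / m2 ^+ 2) * (t ^+ 2 * (Num.sqrt n%:R)^-1).

(** If no normal were discarded, the violation probability over [v] would be exactly [r]; discarding
    costs at most the norm tail [gauss_sqnorm_tail]. *)
Lemma slab_slice n t (x : vec R n) : (0 < n)%N -> 0 <= t ->
  let th := t * Num.sqrt (m2 * n%:R) in
  let A := [set p : vec R n * vec R n | slab_violated th p.1 p.2] in
  let r := fine (N01 [set z | t < Num.sqrt (dotv x x / (m2 * n%:R)) * `|z|]) in
  slice_prob (gauss n) A x <= r /\ r <= slice_prob (gauss n) A x + expR (- (n%:R / 2)).
Proof.
move=> n0 t0 th A r.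
have nR : 0 < n%:R :> R by rewrite ltr0n.
have mn : 0 < m2 * n%:R by rewrite mulr_gt0// gmoment2_gt0.
have smn : 0 < Num.sqrt (m2 * n%:R) by rewrite sqrtr_gt0.
have mA : measurable A := @measurable_slab_violated2 n th.
pose B := [set v : vec R n | th < `|dotv v x|].
have mB : measurable B := measurable_absdotv_gt x th.
have rE : (gauss n B = r%:E)%E.
  rewrite -[LHS]fineK ?fin_num_measure// gauss_absdotv_gt; congr (fine (N01 _))%:E.
  apply/seteqP; split => z /=.
    rewrite sqrtrM ?dotv_ge0// sqrtrV ?ltW// /th => h.
    by rewrite mulrAC ltr_pdivlMr.
  rewrite sqrtrM ?dotv_ge0// sqrtrV ?ltW// /th => h.
  by rewrite mulrAC ltr_pdivlMr in h.
have ysE : ysection A x = [set v | slab_violated th v x].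
  by apply/seteqP; split => v /=; rewrite /ysection/= inE.
have mys : measurable (ysection A x) by exact: measurable_ysection.
split.
  rewrite -lee_fin -rE -slice_probE// le_measure ?inE//.
  by rewrite ysE => v /= /andP[].
have mtail := @measurable_sqnorm_gt R n (4 * n%:R).
rewrite -lee_fin EFinD -rE -slice_probE//.
apply: (@le_trans _ _ (gauss n (ysection A x `|` [set v | 4 * n%:R < dotv v v]))); last first.
  apply: le_trans (measureU2 _ _ _) _ => //; rewrite leeD2l//.
  exact: gauss_sqnorm_tail.
rewrite le_measure ?inE//; first exact: measurableU.
rewrite ysE => v /= hv; have [vn|vn] := leP (dotv v v) (4 * n%:R); [left|by right].
by rewrite /slab_violated vn.
Qed.

Lemma exists_hard_family n (t : R) : (0 < n)%N -> 1 <= t ->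
  exists (d : measure_display) (T : measurableType d) (P : probability T R)
         (K : T -> set (vec R n)),
    (forall w, convex_vec (K w) /\ centrally_symmetric (K w)) /\
    measurable [set p : T * vec R n | K p.1 p.2] /\
    forall (d' : measure_display) (U : measurableType d') (Q : probability U R)
           (q : U -> seq bool -> vec R n) (h : U -> seq bool -> vec R n -> bool) (s : nat),
      (forall b : seq bool, measurable_fun setT (fun u => q u b)) ->
      (forall b : seq bool, measurable [set p : U * vec R n | h p.1 b p.2]) ->
      ((1 / 2 - (s%:R * (Num.sqrt 2 * expR (- (t ^+ 2 * m2 / 16))) + error_bound n t))%:E
         <= mq_error P K Q q h s)%E.
Proof.
move=> n0 t1; have t0 : 0 < t by lra.
have nR : 0 < n%:R :> R by rewrite ltr0n.
have m20 := @gmoment2_gt0 R.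
have mn : 0 < m2 * n%:R by rewrite mulr_gt0.
have sn : 0 < Num.sqrt n%:R :> R by rewrite sqrtr_gt0.
have T0 := gtail_gt0 t1.
set th := t * Num.sqrt (m2 * n%:R).
pose A := [set p : vec R n * vec R n | slab_violated th p.1 p.2].
have mA : measurable A := @measurable_slab_violated2 n th.
(* The greedy bound [2 N], normalized by [(N * gtail t) ^+ 2], is then at most [2 / n]. *)
pose N := (Num.truncn (n%:R / gtail t ^+ 2)).+1.
have Nlarge : n%:R / gtail t ^+ 2 < N%:R by exact: truncnS_gt.
have NR : 0 < N%:R :> R by rewrite ltr0n.
have NT : 0 < N%:R * gtail t by rewrite mulr_gt0.
have [v hv] := exists_balanced_family (gauss n) (gauss n) mA N.
pose a (i : 'I_N) (x : vec R n) := slab_violated th (v i) x.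
(* Then [(1 - c) ^+ S] is 2 to the power [- S / (N * gtail t)], which is [1 / 2] when [S] equals
   [N * gtail t], the expected count at squared norm [m2 * n] before long normals are discarded. *)
pose c := 1 - expR (- (ln 2 / (N%:R * gtail t))).
have l2 : 0 <= ln 2 :> R by rewrite ln_ge0//; lra.
have c01 : 0 <= c <= 1.
  rewrite /c; apply/andP; split; last by rewrite gerBl expR_ge0.
  by rewrite subr_ge0 -[leRHS]expR0 ler_expR oppr_le0 divr_ge0// ltW.
have ma i : measurable [set x | a i x] by exact: measurable_slab_violated.
exists _, nat, (query_law 'I_N c01), (query_body a).
split.
  move=> k; rewrite /query_body; split.
  - move=> x y l /= /existsPn hx /existsPn hy /andP[l0 l1]; apply/existsPn => i.
    have := hx i; have := hy i; rewrite /a /slab_violated.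
    case: (decode ([ffun=> false] : {ffun 'I_N -> bool}) k i) => //=.
    case: (dotv (v i) (v i) <= _) => //=; rewrite -!leNgt => hyi hxi.
    have -> : dotv (v i) (l *: x + (1 - l) *: y) = l * dotv (v i) x + (1 - l) * dotv (v i) y.
      rewrite /dotv !mulr_sumr -big_split; apply: eq_bigr => j _.
      by rewrite !mxE/=; ring.
    apply: le_trans (ler_normD _ _) _; rewrite !normrM (ger0_norm l0).
    have l1' : 0 <= 1 - l by lra.
    rewrite (ger0_norm l1').
    have := ler_wpM2l l0 hxi; have := ler_wpM2l l1' hyi; lra.
  - move=> x /=; set w := decode _ k.
    rewrite (_ : avoids a w (- x) = avoids a w x)//.
    congr (~~ _); apply: eq_existsb => i; rewrite /a /slab_violated.
    rewrite (_ : dotv (v i) (- x) = - dotv (v i) x) ?normrN//.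
    by rewrite /dotv -sumrN; apply: eq_bigr => j _; rewrite mxE mulrN.
split; first exact: measurable_query_body.
move=> d U Q q h s mq mh.
pose pi' := slice_prob (gauss n) A.
pose D x : R := \sum_(i < N) (\1_A (v i, x) - pi' x).
(* The coefficients [k1] and [k3] come from [abs_le_amgm] with parameter [sqrt n], applied to
   [D x / (N * gtail t)] and [l - 1]; [k2] collects the constant terms. *)
pose k1 := Num.sqrt n%:R / (2 * (N%:R * gtail t) ^+ 2).
pose k3 := 2 * expR 3 * t ^+ 2 * Num.sqrt n%:R / (m2 * n%:R) ^+ 2.
pose k2 := 1 / 2 * (Num.sqrt n%:R)^-1 + expR (- (n%:R / 2)) / gtail t
  + 2 * expR 3 * (t ^+ 2 * (Num.sqrt n%:R)^-1).
pose E (x : vec R n) := k1 * D x ^+ 2 + k3 * (dotv x x - m2 * n%:R) ^+ 2 + k2.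
have k10 : 0 <= k1 by rewrite divr_ge0 ?sqrtr_ge0// mulr_ge0// sqr_ge0.
have k30 : 0 <= k3.
  by apply: divr_ge0; nonneg.
have k20 : 0 <= k2.
  have sV : 0 <= (Num.sqrt n%:R)^-1 :> R by rewrite invr_ge0 ltW.
  have tail0 : 0 <= expR (- (n%:R / 2)) / gtail t by apply: divr_ge0; nonneg.
  have half0 : 0 <= 1 / 2 :> R by lra.
  rewrite /k2; nonneg.
have mD : measurable_fun [set: vec R n] D.
  apply: measurable_sum => i; apply: measurable_funB.
    have m1A : measurable_fun [set: vec R n * vec R n] (\1_A : _ -> R) by exact: measurable_indic.
    exact: (measurableT_comp m1A (measurable_pair1 (v i))).
  exact: measurable_slice_prob.
have mD2 : measurable_fun [set: vec R n] (fun x => D x ^+ 2) by exact: measurable_funX.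
have mV2 : measurable_fun [set: vec R n] (fun x => (dotv x x - m2 * n%:R) ^+ 2).
  by apply: measurable_funX; apply: measurable_funB => //; exact: measurable_dotvv.
apply: (@mq_error_ge _ _ _ a c c01 ma _ _ E) => //.
- by move=> i; apply: slab_violated_prob => //; exact: ltW.
- by apply: measurable_funD => //; apply: measurable_funD; apply: measurable_funM.
- move=> x; set S := #|_|.
  have SE : D x = S%:R - N%:R * pi' x.
    rewrite /D sumrB sumr_const card_ord mulr_natl; congr (_ - _).
    rewrite /S -sum1_card natr_sum [RHS]big_mkcond/=; apply: eq_bigr => i _.
    rewrite indicE (_ : (_ \in A) = a i x); last by apply/idP/idP; rewrite inE.
    by rewrite inE; case: (a i x).
  set l := dotv x x / (m2 * n%:R).
  have l0 : 0 <= l by rewrite divr_ge0 ?dotv_ge0// ltW.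
  have [r [rE [r1 r2]]] : exists r, r = fine (N01 [set z | t < Num.sqrt l * `|z|]) /\
      (pi' x <= r /\ r <= pi' x + expR (- (n%:R / 2))).
    by eexists; split; [reflexivity | apply: slab_slice => //; exact: ltW].
  have ratio := exp_gtail_ratio t1 l0; rewrite -rE in ratio.
  have pi0 : 0 <= pi' x by exact: slice_prob_ge0.
  have r0 : 0 <= r by exact: le_trans r1.
  have SNT0 : 0 <= S%:R / (N%:R * gtail t) by rewrite divr_ge0// ltW.
  have rT0 : 0 <= r / gtail t by rewrite divr_ge0// ltW.
  have -> : (1 - c) ^+ S = expR (- (ln 2 * (S%:R / (N%:R * gtail t)))).
    by rewrite /c opprB addrC subrK -expRM_natl; congr expR; ring.
  have lip := exp_ln2_lipschitz SNT0 rT0.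
  (* The comparison with [1 / 2] passes through [r / gtail t]: the first leg is the count deviation
     and the discarded mass, the second the effect of the norm of [x]. *)
  have tri := ler_normD (expR (- (ln 2 * (S%:R / (N%:R * gtail t)))) - expR (- (ln 2 * (r / gtail t))))
    (expR (- (ln 2 * (r / gtail t))) - 1 / 2).
  rewrite addrA subrK in tri.
  have split2 := ler_normD (D x / (N%:R * gtail t)) (- ((r - pi' x) / gtail t)).
  rewrite (_ : D x / _ + _ = S%:R / (N%:R * gtail t) - r / gtail t) in split2; last first.
    by rewrite SE; field; rewrite !gt_eqF.
  have tailb : `|- ((r - pi' x) / gtail t)| <= expR (- (n%:R / 2)) / gtail t.
    rewrite normrN ger0_norm ?divr_ge0 ?subr_ge0 ?(ltW T0)//.
    by rewrite ler_pM2r ?invr_gt0//; lra.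
  have amD := abs_le_amgm (D x / (N%:R * gtail t)) sn.
  have aml := abs_le_amgm (l - 1) sn.
  have e3 : 0 < expR 3 :> R by rewrite expR_gt0.
  have et : 0 <= 4 * expR 3 * t ^+ 2 by rewrite !mulr_ge0 ?sqr_ge0// ltW.
  have := ler_wpM2l et aml; rewrite -/l => amlt.
  have lE : l - 1 = (dotv x x - m2 * n%:R) / (m2 * n%:R) by rewrite /l; field; rewrite !gt_eqF.
  have E1 : k1 * D x ^+ 2 = Num.sqrt n%:R * (D x / (N%:R * gtail t)) ^+ 2 / 2.
    by rewrite /k1; field; rewrite !gt_eqF.
  have E3 : k3 * (dotv x x - m2 * n%:R) ^+ 2 =
      4 * expR 3 * t ^+ 2 * (Num.sqrt n%:R * (l - 1) ^+ 2 / 2).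
    by rewrite /k3 lE; field; rewrite !gt_eqF.
  rewrite /E E1 E3 /k2; lra.
have k1D0 x : [set: vec R n] x -> (0 <= (k1 * D x ^+ 2)%:E)%E.
  by move=> _; rewrite lee_fin mulr_ge0// sqr_ge0.
have k3V0 x : [set: vec R n] x -> (0 <= (k3 * (dotv x x - m2 * n%:R) ^+ 2)%:E)%E.
  by move=> _; rewrite lee_fin mulr_ge0// sqr_ge0.
have mk1D : measurable_fun [set: vec R n] (fun x => (k1 * D x ^+ 2)%:E).
  by apply/measurable_EFinP; exact: measurable_funM.
have mk3V : measurable_fun [set: vec R n] (fun x => (k3 * (dotv x x - m2 * n%:R) ^+ 2)%:E).
  by apply/measurable_EFinP; exact: measurable_funM.
have -> : (\int[gauss n]_x (E x)%:E = \int[gauss n]_x ((k1 * D x ^+ 2)%:E +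
    (k3 * (dotv x x - m2 * n%:R) ^+ 2)%:E + k2%:E))%E.
  by apply: eq_integral => x _; rewrite -!EFinD.
have kDV0 x : [set: vec R n] x -> (0 <= (k1 * D x ^+ 2)%:E +
    (k3 * (dotv x x - m2 * n%:R) ^+ 2)%:E)%E.
  by move=> xT; apply: adde_ge0; [exact: k1D0 | exact: k3V0].
have k2_ge0 (x : vec R n) : [set: vec R n] x -> (0 <= k2%:E)%E by move=> _; rewrite lee_fin.
rewrite (ge0_integralD _ measurableT kDV0 (emeasurable_funD mk1D mk3V) k2_ge0 (measurable_cst _)).
rewrite (ge0_integralD _ measurableT k1D0 mk1D k3V0 mk3V) integral_probability_cst.
under eq_integral do rewrite EFinM.
under [X in (_ + X + _)%E]eq_integral do rewrite EFinM.
rewrite !ge0_integralZl//; try by move=> x _; rewrite lee_fin sqr_ge0.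
  apply: le_trans (leeD2r _ (leeD (lee_wpmul2l _ hv) (lee_wpmul2l _ (gauss_sqnorm_variance n)))) _;
    rewrite ?lee_fin//.
  rewrite /error_bound /k2.
  have nE : n%:R = Num.sqrt n%:R ^+ 2 :> R by rewrite sqr_sqrtr ?ltW.
  have b1 : k1 * (2 * N%:R) <= (Num.sqrt n%:R)^-1.
    have -> : k1 * (2 * N%:R) = Num.sqrt n%:R / (N%:R * gtail t ^+ 2).
      by rewrite /k1; field; rewrite !gt_eqF.
    rewrite ler_pdivrMr ?mulr_gt0 ?exprn_gt0// mulrC ler_pdivlMr// -expr2 -nE.
    by rewrite -ler_pdivrMr ?exprn_gt0// ltW.
  have b3 : k3 * (m4 * n%:R) = 2 * expR 3 * (m4 / m2 ^+ 2) * (t ^+ 2 * (Num.sqrt n%:R)^-1).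
    by rewrite /k3 [in LHS]nE sqrtr_sqr (ger0_norm (ltW sn)); field; rewrite !gt_eqF.
  lra.
all: by apply/measurable_EFinP.
Qed.

End hard_family.

(** * Choice of the slab width and of the absolute constant *)

Lemma gauss_expect_ge0 (R : realType) n (g : vec R n -> \bar R) :
  (forall x, 0 <= g x)%E -> (0 <= gauss_expect g)%E.
Proof.
move=> g0; suff iter_ge0 k (f : seq R -> \bar R) :
  (forall l, 0 <= f l)%E -> (0 <= gauss_iter k f)%E by exact: iter_ge0.
elim: k f => [|k IH] f f0 /=; first exact: f0.
by apply: integral_ge0 => t _; apply: IH.
Qed.

Lemma mq_error_ge0 (R : realType) n d (T : measurableType d) (P : probability T R)
    (K : T -> set (vec R n)) d' (U : measurableType d') (Q : probability U R) q h s :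
  (0 <= mq_error P K Q q h s)%E.
Proof.
apply: integral_ge0 => w _; apply: integral_ge0 => u _.
by apply: gauss_expect_ge0 => x; rewrite lee_fin.
Qed.

(** The Mills bound leaves a factor [t * expR (t ^+ 2 / 2)], and [t <= expR (t ^+ 2 / 2)]. *)
Lemma invr_gtail_le (R : realType) (t : R) : 1 <= t ->
  (gtail t)^-1 <= expR 2 / normal_pdf 0 1 0 * expR (t ^+ 2).
Proof.
move=> t1; have T0 := gtail_gt0 t1; have P0 := @gauss_pdf0_gt0 R.
have h := gauss_pdf_le_gtail t1; rewrite gauss_pdfE in h.
have e2 : 0 < expR 2 :> R by rewrite expR_gt0.
have e0 := expR_gt0 (t ^+ 2 / 2).
have et : t <= expR (t ^+ 2 / 2).
  by have := expR_ge1Dx (t ^+ 2 / 2); have := sqr_ge0 (t - 1); lra.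
rewrite -[leLHS]mul1r ler_pdivrMr//.
have -> : expR (t ^+ 2) = expR (t ^+ 2 / 2) * expR (t ^+ 2 / 2).
  by rewrite -expRD; congr expR; field.
rewrite expRN ler_pdivrMr// in h.
have -> : expR 2 / normal_pdf 0 1 0 * (expR (t ^+ 2 / 2) * expR (t ^+ 2 / 2)) * gtail t =
    expR 2 * expR (t ^+ 2 / 2) * gtail t * expR (t ^+ 2 / 2) / normal_pdf 0 1 0.
  by field; rewrite gt_eqF.
rewrite ler_pdivlMr// mul1r; apply: (le_trans h).
by rewrite !ler_pM2r// ler_pM2l.
Qed.

Theorem theorem1p5 (R : realType) :
  exists C : R, exists N : nat, forall n : nat, (N <= n)%N ->
  forall s : nat, (n <= s)%N ->
  exists (d : measure_display) (T : measurableType d) (P : probability T R)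
         (K : T -> set (vec R n)),
    (forall w, convex_vec (K w) /\ centrally_symmetric (K w)) /\
    measurable [set p : T * vec R n | K p.1 p.2] /\
    forall (d' : measure_display) (U : measurableType d') (Q : probability U R)
           (q : U -> seq bool -> vec R n) (h : U -> seq bool -> vec R n -> bool),
      (forall b : seq bool, measurable_fun setT (fun u => q u b)) ->
      (forall b : seq bool, measurable [set p : U * vec R n | h p.1 b p.2]) ->
      ((1 / 2 - C * ln (s%:R) * Num.sqrt (ln (n%:R)) / Num.sqrt (n%:R))%:E
         <= mq_error P K Q q h s)%E.
Proof.
pose m := @gmoment R 2; pose C3 : R := 2 * expR 3 * (1 + @gmoment R 4 / m ^+ 2).
pose kap : R := expR 2 / normal_pdf 0 1 0.
have m0 : 0 < m by exact: gmoment2_gt0.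
have kap0 : 0 <= kap by rewrite divr_ge0 ?expR_ge0// normal_pdf_ge0.
have m4_0 : 0 <= @gmoment R 4.
  by apply: fine_ge0; apply: integral_ge0 => z _; rewrite lee_fin exprn_even_ge0.
have C30 : 0 <= C3.
  have : 0 <= @gmoment R 4 / m ^+ 2 by rewrite divr_ge0// sqr_ge0.
  by move=> ?; rewrite /C3; nonneg.
(* Here [7 / 2] is 2 from the queries plus [3 / 2] from [error_bound], [4 * kap] pays for discarded
   normals, [C3 * (32 / m)] for the norm of [x], and [64 / m] makes the bound trivial for very large
   [s]. *)
pose C : R := 7 / 2 + 4 * kap + C3 * (32 / m) + 64 / m.
have m32_ge0 : 0 <= 32 / m by rewrite divr_ge0// ltW.
have m64_ge0 : 0 <= 64 / m by rewrite divr_ge0// ltW.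
have C3m_ge0 : 0 <= C3 * (32 / m) by rewrite mulr_ge0.
have C0 : 0 <= C by rewrite /C; lra.
(* This size of [n] ensures [1 <= ln n], and [m <= 32 * ln s], which gives [1 <= t] below. *)
exists C, (Num.truncn (expR (1 + m / 32))).+1 => n nlarge s ns.
have nbig : expR (1 + m / 32) <= n%:R :> R.
  by apply: le_trans (ltW (truncnS_gt _)) _; rewrite ler_nat.
have n1 : 1 <= n%:R :> R.
  by apply: le_trans nbig; rewrite -[leLHS]expR0 ler_expR addr_ge0// divr_ge0// ltW.
have nR : 0 < n%:R :> R by lra.
have n0 : (0 < n)%N by rewrite -(ltr0n R).
have sR : n%:R <= s%:R :> R by rewrite ler_nat.
have s0 : 0 < s%:R :> R by lra.
have lnn : 1 + m / 32 <= ln n%:R by rewrite -[leLHS]expRK ler_ln ?posrE ?expR_gt0.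
have lns : 1 + m / 32 <= ln s%:R by apply: le_trans lnn _; rewrite ler_ln ?posrE.
have m32 : 0 < m / 32 by rewrite divr_gt0.
set L := ln s%:R in lns *.
have L1 : 1 <= L by lra.
set rn := Num.sqrt n%:R; have rn0 : 0 < rn by rewrite sqrtr_gt0.
have rnn : rn ^+ 2 = n%:R by rewrite sqr_sqrtr// ltW.
have rn1 : 1 <= rn by rewrite -[leLHS]sqrtr1 ler_wsqrtr.
have rl1 : 1 <= Num.sqrt (ln n%:R) :> R.
  by rewrite -[leLHS]sqrtr1 ler_wsqrtr//; lra.
have CL : C * L * Num.sqrt (ln n%:R) / rn >= C * L / rn.
  rewrite ler_pM2r ?invr_gt0// ler_peMr// mulr_ge0//; lra.
(* For large [L] the subtracted term is at least [sqrt n / 2], so the claimed bound is nonpositive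
   and any family serves, for instance that of threshold parameter 1. *)
have [Lbig|Lsmall] := ltP (m / 128 * n%:R) L.
  have [d [T [P [K [HK [mK _]]]]]] := exists_hard_family n0 (lexx (1 : R)).
  exists d, T, P, K; split=> //; split=> // d' U Q q h _ _.
  apply: le_trans (mq_error_ge0 _ _ _ _ _ _); rewrite lee_fin.
  have : 64 / m * (m / 128 * n%:R) / rn <= C * L / rn.
    rewrite ler_pM2r ?invr_gt0//; apply: ler_pM => //; last exact: ltW.
    - by rewrite mulr_ge0// ?divr_ge0// ltW.
    - by rewrite /C lerDr; lra.
  have -> : 64 / m * (m / 128 * n%:R) / rn = rn / 2.
    by rewrite -rnn; field; rewrite !gt_eqF.
  lra.
(* This choice makes [expR (- (t ^+ 2 * m / 16))] equal to [s ^- 2], so that the [s] queries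
   together cost [sqrt 2 / s]. *)
pose t := Num.sqrt (32 * L / m).
have L0 : 0 <= 32 * L by lra.
have t2 : t ^+ 2 = 32 * L / m by rewrite sqr_sqrtr// divr_ge0// ltW.
have t1 : 1 <= t.
  rewrite -[leLHS]sqrtr1 ler_wsqrtr// ler_pdivlMr// mul1r; lra.
have [d [T [P [K [HK [mK bound]]]]]] := exists_hard_family n0 t1.
exists d, T, P, K; split=> //; split=> // d' U Q q h mq mh.
apply: le_trans (bound d' U Q q h s mq mh); rewrite lee_fin lerD2l lerN2.
apply: le_trans CL.
have sE : s%:R = expR L by rewrite lnK// posrE.
have iv0 : 0 < rn^-1 by rewrite invr_gt0.
have ivn : n%:R^-1 <= rn^-1 by rewrite lef_pV2 ?posrE// -rnn expr2 ler_peMr// ltW.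
have q1 : s%:R * (Num.sqrt 2 * expR (- (t ^+ 2 * m / 16))) <= 2 * rn^-1.
  have -> : expR (- (t ^+ 2 * m / 16)) = s%:R^-1 * s%:R^-1.
    by rewrite sE -expRN -expRD t2; congr expR; field; rewrite gt_eqF.
  have -> : s%:R * (Num.sqrt 2 * (s%:R^-1 * s%:R^-1)) = Num.sqrt 2 * s%:R^-1 :> R.
    by field; rewrite gt_eqF.
  apply: ler_pM; rewrite ?sqrtr_ge0 ?invr_ge0 ?(ltW s0)//.
    by rewrite -(@ler_pXn2r _ 2)// ?nnegrE ?sqrtr_ge0// sqr_sqrtr//; lra.
  by apply: le_trans ivn; rewrite lef_pV2 ?posrE.
have q2 : expR (- (n%:R / 2)) / gtail t <= 4 * kap * rn^-1.
  apply: le_trans (ler_wpM2l (expR_ge0 _) (invr_gtail_le t1)) _.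
  rewrite -/kap mulrCA -expRD.
  (* For small [L], [t ^+ 2 <= n / 4], so the exponential is at most [expR (- (n / 4)) <= 4 / n]. *)
  have : expR (- (n%:R / 2) + t ^+ 2) <= 4 * rn^-1.
    apply: le_trans (_ : expR (- (n%:R / 4)) <= _).
      rewrite ler_expR t2; have : 32 * L / m <= n%:R / 4; last by lra.
      by rewrite ler_pdivrMr//; lra.
    rewrite expRN; apply: le_trans (_ : (n%:R / 4)^-1 <= _).
      rewrite lef_pV2 ?posrE ?expR_gt0 ?divr_gt0//.
      by have := expR_ge1Dx (n%:R / 4 : R); lra.
    by rewrite invf_div ler_wpM2l.
  by move=> /(ler_wpM2l kap0); lra.
have q3 : C3 * (t ^+ 2 * rn^-1) = C3 * (32 / m) * (L * rn^-1).
  by rewrite t2; field; rewrite !gt_eqF.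
rewrite /error_bound -/m -/rn -/C3 q3.
have ivL : rn^-1 <= L * rn^-1 by rewrite ler_peMl// ltW.
have Lrn0 : 0 <= L * rn^-1 by apply: le_trans ivL; exact: ltW.
have c64 : 0 <= 64 / m * (L * rn^-1) by rewrite mulr_ge0.
have c1 : (7 / 2 + 4 * kap) * rn^-1 <= (7 / 2 + 4 * kap) * (L * rn^-1).
  by rewrite ler_wpM2l//; lra.
have -> : C * L / rn = (7 / 2 + 4 * kap) * (L * rn^-1) + C3 * (32 / m) * (L * rn^-1) +
    64 / m * (L * rn^-1) by rewrite /C -mulrA; ring.
move: q1 q2 c1 c64; rewrite [(_ + 4 * kap) * rn^-1]mulrDl; clear; lra.
Qed.
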